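(* Let $\mathfrak{g}=\mathfrak{g}(A)$ be a Kac–Moody algebra with Dynkin node set $I$ and Weyl group $W$, let $(\Lambda,K)\in P^+\times Z^+$, and let $I'\subset I$ be such that the parabolic subgroup $W_{\mathrm{fin}}=W_{I'}$ is a finite irreducible Weyl group. Let $i\in I'$, $J=I'\setminus\{i\}$, and suppose that $W^J$ (the set of minimal length coset representatives of $W_{I'}/W_J$) is a distributive lattice under the (restricted) left weak order. Let $\Gamma_s^J(\Lambda)$ and $\Gamma_w^J(K)$ be the induced subgraphs of $\Gamma_s(\Lambda)$ and $\Gamma_w(K)$ on the vertex set $W^J$, regarded as edge-labeled posets whose edge labels are the edge multiplicities. Then $\Gamma_s^J(\Lambda)$ and $\Gamma_w^J(K)$ are distributively labeled lattices.
   Context: Notation: simple roots $\alpha_i$, simple coroots $\alpha_i^\vee$, fundamental weights $\Lambda_i$, pairing $\langle\cdot,\cdot\rangle$; $W$ generated by $s_i$, length $\ell$; positive real roots $\Delta_{re}^+$; for $\alpha=u\alpha_i$, $\alpha^\vee=u\alpha_i^\vee$, $s_\alpha=us_iu^{-1}$. Strong (Bruhat) order covers: $w\lessdot ws_\alpha$ ($\alpha\in\Delta_{re}^+$, $\ell(ws_\alpha)=\ell(w)+1$); left weak order covers: $w\prec s_iw$ ($\ell(s_iw)=\ell(w)+1$). $P^+$: dominant integral weights. $Z^+=Z(\mathfrak{g})\cap\bigoplus_i\mathbb{Z}_{\ge0}\alpha_i^\vee$, $K=\sum_ik_i\alpha_i^\vee$. $\Gamma_s(\Lambda)$: graph on $W$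 with an edge $v\to w$ for each strong cover $v\lessdot w=vs_\alpha$, multiplicity $\langle\alpha^\vee,\Lambda\rangle$. $\Gamma_w(K)$: graph on $W$ with an edge $v\to s_jv$ for each left weak cover $v\prec s_jv$, multiplicity $k_j$. For a finite poset $Q$, $J(Q)$ denotes the lattice of lower order ideals. An edge-labeled poset $(P,\omega)$ (with $\omega$ labeling the cover relations of $P$ by elements of a set $S$) is a distributively labeled lattice if $P\cong J(Q)$ for some finite poset $Q$ and there is a vertex labeling $\pi:Q\to S$ with $\omega(I_0\setminus\{q\}\lessdot I_0)=\pi(q)$ for every $I_0\in J(Q)$ and every $q$ maximal in $I_0$. *)

(* Defs.v *)
From HB Require Import structures.
From Stdlib Require Import Relation_Operators.
From mathcomp Require Import all_boot all_order all_algebra.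

Set Implicit Arguments.
Unset Strict Implicit.
Unset Printing Implicit Defensive.

Import Order.TTheory GRing.Theory Num.Theory.
Local Open Scope ring_scope.

(* Posets are given by a domain [D] inside an ambient type together with a
   relation that is only considered on [D]. *)
Section Posets.

Definition order_isomorphism (T U : Type) (D : T -> Prop) (leT : T -> T -> Prop)
    (E : U -> Prop) (leU : U -> U -> Prop) (f : T -> U) : Prop :=
  [/\ forall x, D x -> E (f x),
      forall x y, D x -> D y -> f x = f y -> x = y,
      forall z, E z -> exists2 x, D x & f x = z
    & forall x y, D x -> D y -> (leT x y <-> leU (f x) (f y))].

Definition is_distributive_lattice (T : Type) (D : T -> Prop)
    (le : T -> T -> Prop) : Prop :=
  exists (d : Order.disp_t) (L : distrLatticeType d) (f : T -> L),
    order_isomorphism D le (fun _ => True) (fun a b : L => (a <= b)%O) f.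

Definition partial_order_on (T : Type) (D : T -> Prop)
    (le : T -> T -> Prop) : Prop :=
  [/\ forall x, D x -> le x x,
      forall x y, D x -> D y -> le x y -> le y x -> x = y
    & forall x y z, D x -> D y -> D z -> le x y -> le y z -> le x z].

Definition covers_on (T : Type) (D : T -> Prop) (le : T -> T -> Prop)
    (x y : T) : Prop :=
  [/\ D x, D y, le x y, x <> y
    & forall z, D z -> le x z -> le z y -> z = x \/ z = y].

(* [lab x y m] means that the cover of [x] by [y] carries the label [m];
   the last two clauses say that [lab] is a function on the covers. *)
Definition edge_labeled_poset (T S : Type) (D : T -> Prop)
    (le : T -> T -> Prop) (lab : T -> T -> S -> Prop) : Prop :=
  [/\ partial_order_on D le,
      forall x y m, D x -> D y -> lab x y m -> covers_on D le x y
    & forall x y, covers_on D le x y -> exists! m, lab x y m].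

Definition lower_ideal (d : Order.disp_t) (Q : finPOrderType d)
    (I0 : {set Q}) : Prop :=
  forall x y : Q, x \in I0 -> (y <= x)%O -> y \in I0.

Definition maximal_in (d : Order.disp_t) (Q : finPOrderType d)
    (I0 : {set Q}) (q : Q) : Prop :=
  q \in I0 /\ forall x : Q, x \in I0 -> (q <= x)%O -> x = q.

Definition distributively_labeled_lattice (T S : Type) (D : T -> Prop)
    (le : T -> T -> Prop) (lab : T -> T -> S -> Prop) : Prop :=
  edge_labeled_poset D le lab /\
  exists (d : Order.disp_t) (Q : finPOrderType d) (f : T -> {set Q})
         (p : Q -> S),
    order_isomorphism D le (@lower_ideal d Q)
      (fun X Y : {set Q} => X \subset Y) f /\
    forall (I0 : {set Q}) (q : Q) (x y : T),
      lower_ideal I0 -> maximal_in I0 q -> D x -> D y ->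
      f x = I0 :\ q -> f y = I0 -> lab x y (p q).

(* The order carried by the subgraph induced on [D] of a graph with labeled
   edges: reachability along edges with both ends in [D]. *)
Definition induced_graph_le (T S : Type) (D : T -> Prop)
    (lab : T -> T -> S -> Prop) : T -> T -> Prop :=
  clos_refl_trans T (fun x y => [/\ D x, D y & exists m, lab x y m]).

(* An edge label of the graph is its multiplicity; an edge of multiplicity 0
   is kept as a cover labeled 0. *)
Definition induced_graph_is_dll (T : Type) (D : T -> Prop)
    (lab : T -> T -> nat -> Prop) : Prop :=
  distributively_labeled_lattice D (induced_graph_le D lab) lab.

End Posets.

Definition generalized_cartan_matrix (n : nat) (A : 'M[int]_n) : Prop :=
  [/\ forall i, A i i = 2,
      forall i j, i != j -> A i j <= 0
    & forall i j, A i j = 0 -> A j i = 0].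

Record realization (F : fieldType) (n : nat) (A : 'M[int]_n) := Realization {
  cartan : vectType F;
  simple_root : 'I_n -> 'Hom(cartan, F^o);
  simple_coroot : 'I_n -> cartan;
  simple_root_free : free [seq simple_root i | i : 'I_n];
  simple_coroot_free : free [seq simple_coroot i | i : 'I_n];
  simple_pairing : forall i j,
    simple_root j (simple_coroot i) = (A i j)%:~R;
  dim_cartan :
    \dim {: cartan} = (2 * n - \rank (map_mx (intr : int -> F) A))%N
}.

Record lie_algebra (F : fieldType) := LieAlgebra {
  lie_sort :> lmodType F;
  bracket : lie_sort -> lie_sort -> lie_sort;
  bracket_linearl : forall a x y z,
    bracket (a *: x + y) z = a *: bracket x z + bracket y z;
  bracket_linearr : forall a x y z,
    bracket z (a *: x + y) = a *: bracket z x + bracket z y;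
  bracket_alt : forall x, bracket x x = 0;
  bracket_jacobi : forall x y z,
    bracket x (bracket y z) + bracket y (bracket z x)
      + bracket z (bracket x y) = 0
}.

Definition lie_center (F : fieldType) (g : lie_algebra F) (x : g) : Prop :=
  forall y : g, bracket x y = 0.

Definition lie_subspace (F : fieldType) (g : lie_algebra F)
    (X : g -> Prop) : Prop :=
  X 0 /\ forall a x y, X x -> X y -> X (a *: x + y).

Definition lie_subalgebra (F : fieldType) (g : lie_algebra F)
    (X : g -> Prop) : Prop :=
  lie_subspace X /\ forall x y, X x -> X y -> X (bracket x y).

Definition lie_ideal (F : fieldType) (g : lie_algebra F)
    (X : g -> Prop) : Prop :=
  lie_subspace X /\ forall x y, X y -> X (bracket x y).

(* The quotient of the Lie algebra presented by the Chevalley relations by its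
   largest ideal meeting the Cartan subalgebra trivially is, up to isomorphism,
   the only Lie algebra with these properties (Kac, Infinite dimensional Lie
   algebras, Proposition 1.4). *)
Record kac_moody_algebra (F : fieldType) (n : nat) (A : 'M[int]_n)
    (R : realization F A) := KacMoodyAlgebra {
  km_lie :> lie_algebra F;
  km_cartan : {linear cartan R -> km_lie};
  km_e : 'I_n -> km_lie;
  km_f : 'I_n -> km_lie;
  km_cartan_inj : injective km_cartan;
  km_cartan_comm : forall x y, bracket (km_cartan x) (km_cartan y) = 0;
  km_ef : forall i j, bracket (km_e i) (km_f j) =
    if i == j then km_cartan (simple_coroot R i) else 0;
  km_he : forall x i,
    bracket (km_cartan x) (km_e i) = (simple_root R i x : F) *: km_e i;
  km_hf : forall x i,
    bracket (km_cartan x) (km_f i) = - ((simple_root R i x : F) *: km_f i);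
  km_generated : forall X : km_lie -> Prop,
    lie_subalgebra X -> (forall i, X (km_e i)) -> (forall i, X (km_f i)) ->
    (forall x, X (km_cartan x)) -> forall z, X z;
  km_no_ideal : forall X : km_lie -> Prop,
    lie_ideal X -> (forall x, X (km_cartan x) -> x = 0) ->
    forall z, X z -> z = 0
}.

Section Weyl.
Variables (F : fieldType) (n : nat) (A : 'M[int]_n) (R : realization F A).
Local Notation h := (cartan R).
Local Notation alpha := (simple_root R).
Local Notation alphav := (simple_coroot R).

Definition simple_reflection_fun (i : 'I_n) (x : h) : h :=
  x - (alpha i x : F) *: alphav i.

Fact simple_reflection_fun_is_linear (i : 'I_n) :
  linear (simple_reflection_fun i).
Proof.
move=> a x y; rewrite /simple_reflection_fun linearP /= scalerDl opprD.
by rewrite scalerBr scalerA addrACA.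
Qed.

HB.instance Definition _ (i : 'I_n) :=
  GRing.isLinear.Build F h h *:%R (simple_reflection_fun i)
    (simple_reflection_fun_is_linear i).

Definition simple_reflection (i : 'I_n) : 'End(h) :=
  linfun (simple_reflection_fun i).

Definition word_product (s : seq 'I_n) : 'End(h) :=
  foldr (fun i u => (simple_reflection i \o u)%VF) \1%VF s.

(* The simple reflections are involutions, so words in them exhaust the
   generated group. The Weyl group is realized by its faithful action on the
   Cartan subalgebra; [u] acts on weights by precomposition with its inverse. *)
Definition parabolic (X : {set 'I_n}) (u : 'End(h)) : Prop :=
  exists2 s : seq 'I_n, all (mem X) s & u = word_product s.

Definition weyl_group (u : 'End(h)) : Prop := parabolic setT u.

Definition act_weight (u : 'End(h)) (lam : 'Hom(h, F^o)) : 'Hom(h, F^o) :=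
  (lam \o u^-1)%VF.

Definition has_length (u : 'End(h)) (l : nat) : Prop :=
  (exists2 s : seq 'I_n, size s = l & u = word_product s) /\
  forall s : seq 'I_n, u = word_product s -> (l <= size s)%N.

Definition length_succ (v w : 'End(h)) : Prop :=
  exists2 l, has_length v l & has_length w l.+1.

(* [b] is a real root with coroot [bv] and reflection [sb]. *)
Definition real_root (b : 'Hom(h, F^o)) (bv : h) (sb : 'End(h)) : Prop :=
  exists (u : 'End(h)) (i : 'I_n),
    [/\ weyl_group u, b = act_weight u (alpha i), bv = u (alphav i)
      & sb = (u \o simple_reflection i \o u^-1)%VF].

Definition positive_weight (b : 'Hom(h, F^o)) : Prop :=
  exists c : 'I_n -> nat, b = \sum_i alpha i *+ c i.

Definition strong_edge (Lam : 'Hom(h, F^o)) (v w : 'End(h)) (m : nat) : Prop :=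
  exists (b : 'Hom(h, F^o)) (bv : h) (sb : 'End(h)),
    [/\ weyl_group v, real_root b bv sb, positive_weight b,
        w = (v \o sb)%VF /\ length_succ v w
      & (Lam bv : F) = m%:R].

Definition left_weak_cover (j : 'I_n) (v w : 'End(h)) : Prop :=
  [/\ weyl_group v, w = (simple_reflection j \o v)%VF & length_succ v w].

Definition left_weak_le : 'End(h) -> 'End(h) -> Prop :=
  clos_refl_trans 'End(h) (fun v w => exists j, left_weak_cover j v w).

(* [k] lists the coefficients of the central element on the simple coroots. *)
Definition weak_edge (k : 'I_n -> nat) (v w : 'End(h)) (m : nat) : Prop :=
  exists2 j, left_weak_cover j v w & m = k j.

Definition min_coset_rep (X J : {set 'I_n}) (w : 'End(h)) : Prop :=
  parabolic X w /\
  forall u l l', parabolic J u -> has_length w l ->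
    has_length (w \o u)%VF l' -> (l <= l')%N.

Definition finite_parabolic (X : {set 'I_n}) : Prop :=
  exists s : seq 'End(h), forall u, parabolic X u -> u \in s.

Definition dominant_integral (Lam : 'Hom(h, F^o)) : Prop :=
  forall i, exists m : nat, (Lam (alphav i) : F) = m%:R.

End Weyl.

Definition irreducible_nodes (n : nat) (A : 'M[int]_n) (X : {set 'I_n}) : Prop :=
  X != set0 /\
  forall j l, j \in X -> l \in X ->
    connect [rel a b | [&& a \in X, b \in X & A a b != 0]] j l.

(* [Zplus g K k]: [K] is central in [g] and equals the combination of the
   simple coroots with coefficients [k]. *)
Definition Zplus (F : fieldType) (n : nat) (A : 'M[int]_n)
    (R : realization F A) (g : kac_moody_algebra R) (K : cartan R)
    (k : 'I_n -> nat) : Prop :=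
  lie_center (km_cartan g K) /\ K = \sum_i simple_coroot R i *+ k i.

(* Main.v *)
Require Import Defs.
From HB Require Import structures.
From Stdlib Require Import Relation_Operators Operators_Properties.
From mathcomp Require Import all_boot all_order all_algebra.
From mathcomp Require Import zify ring.

Set Implicit Arguments.
Unset Strict Implicit.
Unset Printing Implicit Defensive.

Import Order.TTheory GRing.Theory Num.Theory.
Local Open Scope ring_scope.

(* Words in the simple reflections act on the root and coroot lattices [Z^n]; a
   word is longer than its right multiple by [s_i] exactly when it sends
   [alpha_i] to a negative root (reduction to rank two), whence the strong
   exchange condition.

   In the distributive lattice [W^J] two elements covering a common element have
   a common cover, so every square of left weak covers comes from a pair of
   commuting simple reflections.  Hence in [W^J] a strong cover [v < t v], [t]
   the reflection in a positive root [gamma], is a left weak cover: if [gamma] is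
   not simple, choose a simple [alpha_j] with [<alpha_j, gamma^vee> > 0];
   multiplying [v] and [t v] by [s_j] on the left gives a strong cover in [W^J]
   with a shorter coroot, whose root is simple by induction, and a square of
   [W^J] then forces [s_j] to fix that root.

   Writing [W^J = J(Q)] by Birkhoff's theorem, two covers removing the same [q]
   are joined by a chain of squares, along which both the index [j] of
   [x < s_j x] and the coroot [x^-1 (alpha_j^vee)] are constant; the labels
   [k_j] and [<x^-1 (alpha_j^vee), Lambda>] depend only on these. *)

(** * Reflections on the root lattice *)

Section LatticeAction.
Variable n : nat.
Implicit Types (C : 'M[int]_n) (x y : 'rV[int]_n) (s t : seq 'I_n).

Definition unit_row (i : 'I_n) : 'rV[int]_n := delta_mx 0 i.

(** For [C = A], [y] holds coroot coordinates and [x] root coordinates; transposing [C] exchanges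
    the two roles. *)
Definition pairing C y x : int := (y *m C *m x^T) 0 0.

Definition lattice_refl C i x := x - pairing C (unit_row i) x *: unit_row i.

Definition lattice_act C s x := foldr (lattice_refl C) x s.

Definition nonneg x := forall j, 0 <= x 0 j.

Lemma unit_rowE i j : unit_row i 0 j = (i == j)%:R.
Proof. by rewrite mxE eqxx eq_sym. Qed.

Lemma pairing_scalar C y : scalar (pairing C y).
Proof.
by move=> a u v; rewrite /pairing linearP /= mulmxDr -scalemxAr !mxE.
Qed.

HB.instance Definition _ C y :=
  GRing.isLinear.Build int 'rV[int]_n int *%R (pairing C y) (pairing_scalar C y).

Lemma pairing_tr C x y : pairing C^T x y = pairing C y x.
Proof.
rewrite /pairing (_ : x *m C^T *m y^T = (y *m C *m x^T)^T) 1?mxE //.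
by rewrite !trmx_mul trmxK mulmxA.
Qed.

Lemma pairing_unit C i j : pairing C (unit_row i) (unit_row j) = C i j.
Proof.
rewrite /pairing -rowE !mxE (bigD1 j) //= big1 ?addr0 ?mxE ?eqxx ?mulr1 //.
by move=> k; rewrite !mxE eqxx /= => /negbTE ->; rewrite mulr0.
Qed.

Lemma pairingB C y z x : pairing C (y - z) x = pairing C y x - pairing C z x.
Proof. by rewrite -!(pairing_tr C) linearB. Qed.

Lemma pairingZl C a y x : pairing C (a *: y) x = a * pairing C y x.
Proof. by rewrite -!(pairing_tr C) linearZ. Qed.

Lemma pairingE C y x : pairing C y x = \sum_j x 0 j * pairing C y (unit_row j).
Proof.
rewrite {1}[x]row_sum_delta linear_sum; apply: eq_bigr => j _.
by rewrite linearZ.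
Qed.

Lemma lattice_refl_linear C i : linear (lattice_refl C i).
Proof.
move=> a x y; rewrite /lattice_refl linearP /= scalerDl opprD scalerBr scalerA.
by rewrite addrACA.
Qed.

HB.instance Definition _ C i := GRing.isLinear.Build int 'rV[int]_n 'rV[int]_n
  *:%R (lattice_refl C i) (lattice_refl_linear C i).

Lemma lattice_act_linear C s : linear (lattice_act C s).
Proof.
by move=> a x y; elim: s => //= i s; rewrite /lattice_act => /= ->; rewrite linearP.
Qed.

HB.instance Definition _ C s := GRing.isLinear.Build int 'rV[int]_n 'rV[int]_n
  *:%R (lattice_act C s) (lattice_act_linear C s).

Lemma lattice_act_cat C s t x :
  lattice_act C (s ++ t) x = lattice_act C s (lattice_act C t x).
Proof. by rewrite /lattice_act foldr_cat. Qed.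

Lemma lattice_act_cons C i s x :
  lattice_act C (i :: s) x = lattice_refl C i (lattice_act C s x).
Proof. by []. Qed.

Lemma lattice_reflE C i x j :
  lattice_refl C i x 0 j = x 0 j - (i == j)%:R * pairing C (unit_row i) x.
Proof. by rewrite !mxE eqxx eq_sym mulrC. Qed.

Lemma lattice_refl_unit C i j :
  lattice_refl C i (unit_row j) = unit_row j - C i j *: unit_row i.
Proof. by rewrite /lattice_refl pairing_unit. Qed.

Lemma unit_row_nonneg i : nonneg (unit_row i).
Proof. by move=> j; rewrite unit_rowE ler0n. Qed.

Lemma nonnegD x y : nonneg x -> nonneg y -> nonneg (x + y).
Proof. by move=> px py j; rewrite mxE addr_ge0. Qed.

Lemma nonnegZ a x : 0 <= a -> nonneg x -> nonneg (a *: x).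
Proof. by move=> pa px j; rewrite mxE mulr_ge0. Qed.

Lemma nonneg_anti x : nonneg x -> nonneg (- x) -> x = 0.
Proof.
move=> px nx; apply/rowP => j; apply/eqP; rewrite mxE eq_le px andbT.
by have := nx j; rewrite mxE oppr_ge0.
Qed.

Section Cartan.
Variable C : 'M[int]_n.
Hypothesis C2 : forall i, C i i = 2.

Lemma lattice_refl_self i : lattice_refl C i (unit_row i) = - unit_row i.
Proof.
rewrite lattice_refl_unit C2 -{1}[unit_row i]scale1r -scalerBl.
by rewrite -scaleN1r.
Qed.

Lemma lattice_reflK i : involutive (lattice_refl C i).
Proof.
move=> x; rewrite {2}/lattice_refl linearB linearZ /= lattice_refl_self.
by rewrite scalerN opprK /lattice_refl subrK.
Qed.

Lemma lattice_actK s : cancel (lattice_act C s) (lattice_act C (rev s)).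
Proof.
elim: s => //= i s IH x.
by rewrite rev_cons -cats1 lattice_act_cat lattice_act_cons /= lattice_reflK IH.
Qed.

Lemma lattice_actVK s : cancel (lattice_act C (rev s)) (lattice_act C s).
Proof. by move=> x; rewrite -{1}[s]revK lattice_actK. Qed.

Lemma pairing_act s x y :
  pairing C (lattice_act C^T s y) (lattice_act C s x) = pairing C y x.
Proof.
elim: s => // i s <-; rewrite !lattice_act_cons.
move: (lattice_act C s x) (lattice_act C^T s y) => {}x {}y.
rewrite /lattice_refl pairingB pairingZl !linearB !linearZ /= pairing_unit C2.
by rewrite pairing_tr; lia.
Qed.

Lemma lattice_act_reflection g i x :
  lattice_act C (g ++ i :: rev g) x =
  x - pairing C (lattice_act C^T g (unit_row i)) x *: lattice_act C g (unit_row i).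
Proof.
rewrite lattice_act_cat lattice_act_cons /lattice_refl linearB linearZ /=.
rewrite lattice_actVK -[x in pairing _ (lattice_act _ _ _) x](lattice_actVK g).
by rewrite pairing_act.
Qed.

Lemma lattice_act_unit_neq0 s i : lattice_act C s (unit_row i) != 0.
Proof.
apply/eqP => /(congr1 (lattice_act C (rev s))); rewrite lattice_actK linear0.
by move/rowP/(_ i); rewrite unit_rowE mxE eqxx.
Qed.

(* Applying the inverse word exhibits [c] as a divisor of an entry [1]. *)
Lemma multiple_of_simple_root s i a c : 0 <= c ->
  lattice_act C s (unit_row i) = c *: unit_row a -> c = 1.
Proof.
move=> c0 /(congr1 (lattice_act C (rev s))); rewrite lattice_actK linearZ /=.
move/rowP/(_ i); rewrite unit_rowE eqxx mxE /= => c1.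
have m0 : 0 < lattice_act C (rev s) (unit_row a) 0 i by nia.
by move: c0 m0 c1; move: (lattice_act _ _ _ _ _) => m; nia.
Qed.

Lemma root_supported_at s i a :
  nonneg (lattice_act C s (unit_row i)) ->
  (forall j, j != a -> lattice_act C s (unit_row i) 0 j = 0) ->
  lattice_act C s (unit_row i) = unit_row a.
Proof.
move=> pos0 supp; set x := lattice_act _ _ _ in pos0 supp *.
have xE : x = x 0 a *: unit_row a.
  apply/rowP => j; rewrite !mxE eqxx /=; case: (eqVneq j a) => [->|/supp ->].
    by rewrite mulr1.
  by rewrite mulr0.
by rewrite xE (multiple_of_simple_root (pos0 a) xE) scale1r.
Qed.

Lemma root_le_simple s i a y c : 0 < c -> nonneg (lattice_act C s (unit_row i)) ->
  nonneg y -> unit_row a = y + c *: lattice_act C s (unit_row i) ->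
  lattice_act C s (unit_row i) = unit_row a.
Proof.
move=> c0 px py eqa; apply: root_supported_at => // j neja.
move/rowP: eqa => /(_ j); rewrite unit_rowE eq_sym (negbTE neja) !mxE /=.
by have := px j; have := py j; move: (lattice_act _ _ _ _ _) (y _ _) => u v; nia.
Qed.

(** The reflection changes only the coordinate at [a], so a positive root that it makes negative has
    no other nonzero coordinate. *)
Lemma root_refl_neg s i a : nonneg (lattice_act C s (unit_row i)) ->
  nonneg (- lattice_refl C a (lattice_act C s (unit_row i))) ->
  lattice_act C s (unit_row i) = unit_row a.
Proof.
move=> px nx; apply: root_supported_at => // j neja.
have := nx j; rewrite mxE lattice_reflE eq_sym (negbTE neja) mul0r subr0.
by have := px j; lia.
Qed.

End Cartan.
End LatticeAction.

(** * Length and signs of roots *)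

(* The alternating word of length [m] in [a] and [b] ending with [b]. *)
Fixpoint alt_word (T : Type) (a b : T) (m : nat) : seq T :=
  if m is m'.+1 then rcons (alt_word b a m') b else [::].

Lemma alt_word_cons (T : Type) (a b : T) m :
  alt_word a b m.+1 = (if odd m then a else b) :: alt_word a b m.
Proof.
elim: m a b => // m IH a b; rewrite [LHS]/= -/(alt_word b a m.+1) IH /=.
by case: (odd m).
Qed.

Lemma size_alt_word (T : Type) (a b : T) m : size (alt_word a b m) = m.
Proof. by elim: m a b => //= m IH a b; rewrite size_rcons IH. Qed.

Lemma alt_word_suffix (T : Type) (a b : T) e m : (m <= e)%N ->
  exists2 d, alt_word a b e = d ++ alt_word a b m & size d = (e - m)%N.
Proof.
elim: e => [|e IH]; first by rewrite leqn0 => /eqP ->; exists [::].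
rewrite leq_eqVlt => /predU1P[->|]; first by exists [::]; rewrite ?subnn.
rewrite ltnS => le_me; have [d def_d sz_d] := IH le_me.
exists ((if odd e then a else b) :: d); first by rewrite alt_word_cons def_d.
by rewrite /= sz_d subSn.
Qed.

(* [ev] evaluates words in the generators in the group with Cartan matrix [A];
   the pairs in [weyl_braid] are the finite bonds [(a_ij * a_ji, m_ij)]. *)
Record weyl_words (n : nat) (A : 'M[int]_n) (G : eqType)
    (ev : seq 'I_n -> G) : Prop := WeylWords {
  weyl_cartan : generalized_cartan_matrix A;
  weyl_cat : forall s s' t t', ev s = ev s' -> ev t = ev t' ->
    ev (s ++ t) = ev (s' ++ t');
  weyl_invol : forall i, ev [:: i; i] = ev [::];
  weyl_braid : forall i j m, i != j ->
    (A i j * A j i, m) \in [:: (0, 2%N); (1, 3); (2, 4); (3, 6)] ->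
    ev (alt_word i j m) = ev (alt_word j i m);
  weyl_root : forall s t, ev s = ev t -> lattice_act A s =1 lattice_act A t;
  weyl_coroot : forall s t, ev s = ev t ->
    lattice_act A^T s =1 lattice_act A^T t
}.

(** Transposition exchanges roots and coroots, so every sign statement for roots transfers to
    coroots. *)
Lemma weyl_words_tr n (A : 'M[int]_n) (G : eqType) (ev : seq 'I_n -> G) :
  weyl_words A ev -> weyl_words A^T ev.
Proof.
case=> [[A2 Ale A0] catE involE braidE rootE corootE].
split=> //; last by rewrite trmxK.
  split=> [i|i j|i j]; rewrite !mxE //; last exact: A0.
  by rewrite eq_sym; apply: Ale.
by move=> i j m; rewrite !mxE mulrC; apply: braidE.
Qed.

Section Length.
Variables (n : nat) (G : eqType) (ev : seq 'I_n -> G).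
Implicit Types (s t u v : seq 'I_n).

Lemma word_size_exists s :
  exists m, [exists t : m.-tuple 'I_n, ev t == ev s].
Proof. by exists (size s); apply/existsP; exists (in_tuple s). Qed.

Definition len s := ex_minn (word_size_exists s).

Lemma reduced_word s : exists2 t, ev t = ev s & size t = len s.
Proof.
rewrite /len; case: ex_minnP => m /existsP[t /eqP tE] _.
by exists t; rewrite ?size_tuple.
Qed.

Lemma len_min s t : ev t = ev s -> (len s <= size t)%N.
Proof.
move=> ts; rewrite /len; case: ex_minnP => m _; apply.
by apply/existsP; exists (in_tuple t); rewrite /= ts.
Qed.

Lemma len_eq s t : ev s = ev t -> len s = len t.
Proof.
suff le s' t' : ev s' = ev t' -> (len s' <= len t')%N.
  by move=> st; apply/eqP; rewrite eqn_leq !le.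
by move=> st; have [u uE <-] := reduced_word t'; apply: len_min; rewrite uE.
Qed.

End Length.

Section WeylWords.
Variables (n : nat) (A : 'M[int]_n) (G : eqType) (ev : seq 'I_n -> G).
Hypothesis H : weyl_words A ev.
Implicit Types (s t u v : seq 'I_n).
Local Notation len := (len ev).
Local Notation act := (lattice_act A).
Local Notation e := (@unit_row n).

Let A2 i : A i i = 2. Proof. by case: (weyl_cartan H). Qed.
Let Ale i j : i != j -> A i j <= 0.
Proof. by case: (weyl_cartan H) => _ + _; apply. Qed.

Lemma ev_catl u s t : ev s = ev t -> ev (u ++ s) = ev (u ++ t).
Proof. by move=> st; apply: (weyl_cat H). Qed.

Lemma ev_catr u s t : ev s = ev t -> ev (s ++ u) = ev (t ++ u).
Proof. by move=> st; apply: (weyl_cat H). Qed.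

Lemma ev_ii u i v : ev (u ++ i :: i :: v) = ev (u ++ v).
Proof. exact: ev_catl (@ev_catr v [:: i; i] [::] (weyl_invol H i)). Qed.

Lemma ev_iil i v : ev (i :: i :: v) = ev v.
Proof. exact: (ev_ii [::]). Qed.

Lemma ev_revK u s v : ev (u ++ rev s ++ s ++ v) = ev (u ++ v).
Proof.
elim: s v => // i s IH v.
by rewrite rev_cons -cats1 -!catA /= catA ev_ii -catA IH.
Qed.

Lemma ev_Krev u s v : ev (u ++ s ++ rev s ++ v) = ev (u ++ v).
Proof. by rewrite -{1}[s]revK ev_revK. Qed.

Lemma ev_rev s t : ev s = ev t -> ev (rev s) = ev (rev t).
Proof.
move=> st; have := ev_Krev (rev s) t [::]; rewrite !cats0 => <-.
by rewrite (ev_catl _ (ev_catr _ (esym st))) (ev_revK [::]).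
Qed.

Lemma ev_cancelr u s t : ev (s ++ u) = ev (t ++ u) -> ev s = ev t.
Proof.
move/(ev_catr (rev u)); rewrite -!catA.
by have := ev_Krev s u [::]; have := ev_Krev t u [::]; rewrite !cats0 => -> ->.
Qed.

Lemma len_size s : (len s <= size s)%N.
Proof. exact: len_min. Qed.

Lemma len_cat s t : (len (s ++ t) <= len s + len t)%N.
Proof.
have [s' s'E <-] := reduced_word ev s; have [t' t'E <-] := reduced_word ev t.
by rewrite -size_cat; apply: len_min; apply: (weyl_cat H).
Qed.

Lemma len_rev s : len (rev s) = len s.
Proof.
have le t : (len (rev t) <= len t)%N.
  have [t' t'E <-] := reduced_word ev t.
  by rewrite -size_rev; apply: len_min; apply: ev_rev.
by apply/eqP; rewrite eqn_leq le /= -{1}[s]revK le.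
Qed.

(** Coordinates on [alpha_a] and [alpha_b] of the alternating word of length [m] applied to
    [alpha_a], where [x = A a b] and [y = A b a]. *)
Fixpoint alt_coef (x y : int) (m : nat) : int * int :=
  if m is m'.+1 then
    let: (p, q) := alt_coef x y m' in
    if odd m' then (- x * q - p, q) else (p, - y * p - q)
  else (1, 0).

Lemma alt_word_act a b m :
  act (alt_word a b m) (e a) =
  (alt_coef (A a b) (A b a) m).1 *: e a + (alt_coef (A a b) (A b a) m).2 *: e b.
Proof.
elim: m => [|m IH]; first by rewrite /= scale1r scale0r addr0.
rewrite alt_word_cons lattice_act_cons IH [in RHS]/=.
case: (alt_coef _ _ m) => p q /=.
case: (odd m); rewrite linearD !linearZ /= lattice_refl_self //= lattice_refl_unit.
  by apply/rowP => k; rewrite !mxE; ring.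
by apply/rowP => k; rewrite !mxE; ring.
Qed.

(** The third inequality is the invariant that carries the two signs through the induction. *)
Lemma alt_coef_infinite x y m : x <= 0 -> y <= 0 -> 4 <= x * y ->
  let: (p, q) := alt_coef x y m in
  [/\ 0 <= p, 0 <= q & if odd m then 2 * p <= - x * q else 2 * q <= - y * p].
Proof.
move=> x0 y0 xy; elim: m => [|m] /=; first by split; lia.
case: (alt_coef x y m) => p q [p0 q0].
case: (odd m) => /= h; split=> //; first by nia.
(* The two nonnegative products add up to twice the gap in the new inequality. *)
- have: 0 <= (x * y - 4) * q by apply: mulr_ge0; lia.
  have: 0 <= - y * (- x * q - 2 * p) by apply: mulr_ge0; lia.
  by lia.
- by nia.
have: 0 <= (x * y - 4) * p by apply: mulr_ge0; lia.
have: 0 <= - x * (- y * p - 2 * q) by apply: mulr_ge0; lia.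
by lia.
Qed.

(** Since [k <= 6], few values of [m] occur, and in each the signs follow from those of [x] and [y]
    and the value of [x * y]. *)
Lemma alt_coef_finite x y k m : x <= 0 -> y <= 0 ->
  (x * y, k) \in [:: (0, 2%N); (1, 3); (2, 4); (3, 6)] -> (m < k)%N ->
  0 <= (alt_coef x y m).1 /\ 0 <= (alt_coef x y m).2.
Proof.
move=> x0 y0; rewrite !inE !xpair_eqE.
case/or4P => /andP[/eqP xy /eqP ->];
  do 6?[case: m => [|m]; first by move=> _ /=; split; nia];
  by rewrite /= => ?; exfalso; lia.
Qed.

(** Induction on length. With [b] the last letter of a reduced word, [s] is written as [v] times an
    alternating word in [a] and [b], where [v] ascends at both letters. By induction [v] keeps
    [alpha_a] and [alpha_b] positive, and the alternating word sends [alpha_a] to a nonnegative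
    combination of them. *)
Lemma ascent_nonneg s a : (len s <= len (s ++ [:: a]))%N -> nonneg (act s (e a)).
Proof.
have [k] := ubnP (len s); elim: k s a => // k IH s a; rewrite ltnS => len_k asc.
have [s' s's sz_s'] := reduced_word ev s.
case/lastP: s' => [|r b] in s's sz_s'.
  by rewrite -(weyl_root H s's); apply: unit_row_nonneg.
rewrite size_rcons in sz_s'.
have neq_ba : b != a.
  apply/eqP => eq_ba; suff: (len (s ++ [:: a]) <= size r)%N by lia.
  apply: len_min; rewrite -(ev_catr _ s's) -cats1 -catA eq_ba /= ev_ii.
  by rewrite cats0.
(* Inner induction on the size of [v], which shrinks while the alternating suffix grows. *)
suff main m v f : (size v < m)%N -> (0 < f)%N ->
    ev (v ++ alt_word a b f) = ev s -> (size v + f = len s)%N ->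
    nonneg (act s (e a)).
  by apply: (main (size r).+1 r 1%N); rewrite // ?addn1 // cats1.
elim: m v f => // m IHm v f sz_v f0 vs sz_vf.
have len_altl u g : (len (u ++ alt_word a b g) <= len u + g)%N.
  by have := len_cat u (alt_word a b g);
     have := len_size (alt_word a b g); rewrite size_alt_word; lia.
have red_v : len v = size v.
  by have := len_altl v f; have := len_size v; rewrite (len_eq vs); lia.
(* [c] is the first letter of the alternating suffix, [c'] the letter that would prolong it to the
   left. *)
pose c := if odd f then b else a; pose c' := if odd f then a else b.
have posc : nonneg (act v (e c)).
  apply: IH; first by lia.
  have := len_altl (v ++ [:: c]) f.-1; rewrite -catA cat1s.
  suff -> : c :: alt_word a b f.-1 = alt_word a b f by rewrite (len_eq vs); lia.
  case: f {sz_vf vs} f0 @c @c' => //= f _; rewrite -/(alt_word a b f.+1).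
  by rewrite alt_word_cons; case: (odd f).
have [asc'|desc'] := leqP (len v) (len (v ++ [:: c'])); last first.
  have [v1 v1E sz_v1] := reduced_word ev (v ++ [:: c']).
  have v1s : ev (v1 ++ alt_word a b f.+1) = ev s.
    rewrite alt_word_cons -/c' -cat1s catA -vs; apply: ev_catr.
    by rewrite (ev_catr _ v1E) -catA /= ev_ii cats0.
  have le_s : (len s <= size v1 + f.+1)%N.
    rewrite -(size_alt_word a b f.+1) -size_cat; exact: len_min.
  by apply: (IHm v1 f.+1) => //; lia.
have posc' : nonneg (act v (e c')) by apply: IH => //; lia.
have [posa posb] : nonneg (act v (e a)) /\ nonneg (act v (e b)).
  by move: posc posc'; rewrite /c /c'; case: (odd f).
suff [p0 q0] : 0 <= (alt_coef (A a b) (A b a) f).1 /\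
               0 <= (alt_coef (A a b) (A b a) f).2.
  rewrite -(weyl_root H vs) lattice_act_cat alt_word_act linearD !linearZ /=.
  by apply: nonnegD; apply: nonnegZ.
have [ab0 ba0] : A a b <= 0 /\ A b a <= 0 by rewrite !Ale // eq_sym.
have [big|small] := lerP 4 (A a b * A b a).
  have := alt_coef_infinite f ab0 ba0 big.
  by case: (alt_coef _ _ f) => p q [].
have [k0 bond_k0] : exists k0,
    (A a b * A b a, k0) \in [:: (0, 2%N); (1, 3); (2, 4); (3, 6)].
  have: 0 <= A a b * A b a by rewrite mulr_le0.
  move: (A a b * A b a) small => [[|[|[|[|//]]]]|//] _ _;
    by [exists 2%N | exists 3%N | exists 4%N | exists 6%N].
have [le_kf|lt_fk] := leqP k0 f; last exact: alt_coef_finite bond_k0 lt_fk.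
(* The braid relation lets the word end with [a], against the ascent at [a]. *)
have [d dE sz_d] := alt_word_suffix a b le_kf.
have braid : ev (alt_word a b k0) = ev (alt_word b a k0).
  by apply: (weyl_braid H); rewrite // eq_sym.
suff: (len (s ++ [:: a]) <= size (v ++ d ++ alt_word a b k0.-1))%N.
  rewrite !size_cat size_alt_word.
  suff: (0 < k0)%N by lia.
  by move: bond_k0; rewrite !inE !xpair_eqE; case: (k0) => //=; lia.
apply: len_min; rewrite -(ev_catr _ vs) dE -!catA.
apply/esym; rewrite catA (ev_catl (v ++ d) (ev_catr [:: a] braid)) -catA.
case: k0 bond_k0 {le_kf dE braid sz_d} => [|k0 _].
  by rewrite !inE !xpair_eqE; lia.
rewrite /= -cats1 -!catA /=.
by have := ev_ii (v ++ d ++ alt_word a b k0) a [::]; rewrite cats0 -!catA.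
Qed.

End WeylWords.

(** * Signs of roots, strong exchange and commuting squares *)

Section WeylWordsRoots.
Variables (n : nat) (A : 'M[int]_n) (G : eqType) (ev : seq 'I_n -> G).
Hypothesis H : weyl_words A ev.
Implicit Types (s t u v g : seq 'I_n).
Local Notation len := (len ev).
Local Notation act := (lattice_act A).
Local Notation cact := (lattice_act A^T).
Local Notation e := (@unit_row n).

Let A2 i : A i i = 2. Proof. by case: (weyl_cartan H). Qed.

Lemma act_rcons_self s a : act (s ++ [:: a]) (e a) = - act s (e a).
Proof. by rewrite lattice_act_cat lattice_act_cons lattice_refl_self // linearN. Qed.

Lemma len_rcons2 s a : len ((s ++ [:: a]) ++ [:: a]) = len s.
Proof. by apply: len_eq; rewrite -catA /= (ev_ii H) cats0. Qed.

Lemma len_rcons_le s a : (len (s ++ [:: a]) <= (len s).+1)%N.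
Proof. by have := len_cat H s [:: a]; have := len_size ev [:: a]; rewrite /=; lia. Qed.

Lemma descent_nonpos s a :
  (len (s ++ [:: a]) <= len s)%N -> nonneg (- act s (e a)).
Proof.
by rewrite -(len_rcons2 s a) => /(ascent_nonneg H); rewrite act_rcons_self.
Qed.

Lemma root_sign s a : nonneg (act s (e a)) \/ nonneg (- act s (e a)).
Proof.
have [/(ascent_nonneg H)|/ltnW/descent_nonpos] := leqP (len s) (len (s ++ [:: a]));
  by [left | right].
Qed.

Lemma root_not_both s a : nonneg (act s (e a)) -> ~ nonneg (- act s (e a)).
Proof.
move=> p q; have /eqP := lattice_act_unit_neq0 A2 s a; apply.
exact: nonneg_anti.
Qed.

Lemma nonneg_ascent s a : nonneg (act s (e a)) -> len (s ++ [:: a]) = (len s).+1.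
Proof.
move=> p; apply/eqP; rewrite eqn_leq len_rcons_le ltnNge.
by apply/negP => /descent_nonpos; apply: root_not_both.
Qed.

Lemma nonpos_descent s a : nonneg (- act s (e a)) -> len s = (len (s ++ [:: a])).+1.
Proof.
rewrite -act_rcons_self => /nonneg_ascent.
by rewrite len_rcons2.
Qed.

(** Positivity of the root is an ascent of [s] at [a], a condition on lengths that does not
    distinguish [A] from its transpose. *)
Lemma coroot_nonneg s a : nonneg (act s (e a)) -> nonneg (cact s (e a)).
Proof.
move=> /nonneg_ascent lenS; apply: (ascent_nonneg (weyl_words_tr H)).
by rewrite lenS.
Qed.

(** The last letter of a nonempty reduced word is a descent, which would make a fixed simple root
    negative. *)
Lemma act_faithful s : (forall j, act s (e j) = e j) -> ev s = ev [::].
Proof.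
move=> fixs; have [t ts sz_t] := reduced_word ev s.
rewrite -ts; case/lastP: t => [|r b] // in ts sz_t *.
have: nonneg (act s (e b)) by rewrite fixs; apply: unit_row_nonneg.
move=> /nonneg_ascent; suff: (len (s ++ [:: b]) <= size r)%N.
  by rewrite size_rcons in sz_t; lia.
apply: len_min; rewrite -(ev_catr H _ ts) -cats1 -catA /= (ev_ii H).
by rewrite cats0.
Qed.

(* The product of both reflections is a transvection [x |-> x + d(x) a]; as it
   and its inverse respect the sign of roots, [d] vanishes on simple roots. *)
Lemma reflection_of_simple_root g i a :
  act g (e i) = e a -> ev (g ++ i :: rev g) = ev [:: a].
Proof.
move=> gia; pose y := cact g (e i); pose d x := pairing A y x - pairing A (e a) x.
pose t := a :: g ++ i :: rev g.
have tE x : act t x = x + d x *: e a.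
  rewrite lattice_act_cons lattice_act_reflection // gia linearB linearZ /=.
  rewrite lattice_refl_self // /lattice_refl /d -/y.
  by apply/rowP => k; rewrite !mxE; ring.
have da : d (e a) = 0.
  by rewrite /d -{1}gia pairing_act // !pairing_unit !A2.
have tV x : act (rev t) x = x - d x *: e a.
  apply: (can_inj (lattice_actK A2 t)); rewrite lattice_actVK // tE.
  have dB c : d (x - c *: e a) = d x - c * d (e a).
    by rewrite /d !linearB !linearZ /=; ring.
  by rewrite dB da mulr0 subr0 subrK.
have d0 j : d (e j) = 0.
  have [->//|neja] := eqVneq j a.
  (* The image of [alpha_j] has coordinate 1 at [j], so it is a positive root and its coordinate at
     [a] is nonnegative. The inverse of [t] bounds [d] above, [t] itself bounds it below. *)
  apply/eqP; rewrite eq_le; apply/andP; split.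
    case: (root_sign (rev t) j) => /[dup]; rewrite tV => /(_ j) + /(_ a).
      rewrite !mxE !eqxx (eq_sym a j) (negbTE neja) /=; lia.
    rewrite !mxE !eqxx (negbTE neja) /=; lia.
  case: (root_sign t j) => /[dup]; rewrite tE => /(_ j) + /(_ a).
    rewrite !mxE !eqxx (eq_sym a j) (negbTE neja) /=; lia.
  rewrite !mxE !eqxx (negbTE neja) /=; lia.
have: ev t = ev [::] by apply: act_faithful => j; rewrite tE d0 scale0r addr0.
by move=> /(ev_catl H [:: a]); rewrite /= (ev_iil H).
Qed.

(** Both roots define the same reflection; comparing its two expressions at [alpha_a^vee] identifies
    the coroots. *)
Lemma coroot_of_simple_root g i a : act g (e i) = e a -> cact g (e i) = e a.
Proof.
move=> gia; have := weyl_coroot H (reflection_of_simple_root gia) (e a).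
have A2T k : A^T k k = 2 by rewrite mxE.
rewrite lattice_act_reflection // trmxK gia /= lattice_refl_self //.
rewrite pairing_unit A2T => /rowP eqg; apply/rowP => k.
by have := eqg k; rewrite !mxE eqxx; case: (k == a) => /=; lia.
Qed.

(** Read from the right, the letters of [s] turn a positive root negative. At the letter [b] where
    the sign changes the root is [alpha_b], so the conjugated reflection is [s_b] and cancels that
    letter. *)
Lemma strong_exchange s g i :
  nonneg (act g (e i)) -> nonneg (- act s (act g (e i))) ->
  exists s1 b s2, s = s1 ++ b :: s2 /\ ev (s ++ g ++ i :: rev g) = ev (s1 ++ s2).
Proof.
move=> posg; elim: s => [|b s IH] negs.
  by case: (root_not_both posg negs).
have [poss|negs'] := root_sign (s ++ g) i; last first.
  move: negs'; rewrite lattice_act_cat => /IH [s1 [c [s2 [-> eqs]]]].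
  exists (b :: s1), c, s2; split=> //.
  exact: (ev_catl H [:: b]).
exists [::], b, s; split=> //=.
move: negs; rewrite lattice_act_cons -lattice_act_cat => /(root_refl_neg A2 poss).
move=> /reflection_of_simple_root; rewrite rev_cat -catA => eqb.
have := ev_catr H s eqb; rewrite -!catA /= -catA => /(ev_catl H [:: b]) /=.
rewrite (ev_iil H) => <-; apply/esym.
have := ev_revK H (b :: s ++ g ++ i :: rev g) s [::].
by rewrite /= cats0 -!catA /= cats0.
Qed.

Lemma nonpos_reflection_len s g i :
  nonneg (act g (e i)) -> nonneg (- act s (act g (e i))) ->
  (len (s ++ g ++ i :: rev g) < len s)%N.
Proof.
have [t ts sz_t] := reduced_word ev s.
rewrite -(weyl_root H ts) => posg /(strong_exchange posg) [s1 [b [s2 [tE eqt]]]].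
rewrite -(len_eq (ev_catr H _ ts)) -sz_t (len_eq eqt) tE.
by have := len_size ev (s1 ++ s2); rewrite !size_cat /=; lia.
Qed.

(** At [alpha_a] the left product has coordinate -1 at [a], while the right one would have 1 if [d]
    were not [a]. Exchanging the two sides gives [c = b], and the coordinate at [b] then forces
    [A b a = 0]. *)
Lemma commuting_square a b c d : a != b -> c != a -> d != b ->
  ev [:: c; a] = ev [:: d; b] -> [/\ c = b, d = a & A a b = 0].
Proof.
have act2_self i j : act [:: i; j] (e j) = A i j *: e i - e j.
  by rewrite /= lattice_refl_self // linearN /= lattice_refl_unit opprB.
have act2 i j k : act [:: i; j] (e k) =
    e k - A i k *: e i - A j k *: (e j - A i j *: e i).
  by rewrite /= [lattice_refl A j _]lattice_refl_unit linearB linearZ /=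
    !lattice_refl_unit.
suff main a' b' c' d' : a' != b' -> c' != a' -> d' != b' ->
    ev [:: c'; a'] = ev [:: d'; b'] -> d' = a'.
  move=> ab ca db eqw; have da := main _ _ _ _ ab ca db eqw.
  have cb : c = b by apply: (main b a d c) => //; rewrite eq_sym.
  split=> //; subst c d.
  have := weyl_root H eqw (e a); rewrite act2_self act2 => /rowP/(_ b).
  rewrite !mxE !eqxx (eq_sym b a) (negbTE ab) /= => Aba0.
  by case: (weyl_cartan H) => _ _; apply; lia.
move=> ab ca db eqw; apply/eqP; apply: contraT => da.
have := weyl_root H eqw (e a'); rewrite act2_self act2 => /rowP/(_ a').
rewrite !mxE !eqxx (eq_sym a' c') (negbTE ca) (eq_sym a' d').
by rewrite (negbTE da) (negbTE ab) /=; lia.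
Qed.

Lemma commuting_refl a b : A a b = 0 -> lattice_refl A a (e b) = e b.
Proof. by move=> ab0; rewrite lattice_refl_unit ab0 scale0r subr0. Qed.

End WeylWordsRoots.

(** * Strong covers between minimal coset representatives *)

Section MinimalRepresentatives.
Variables (n : nat) (A : 'M[int]_n) (G : eqType) (ev : seq 'I_n -> G).
Hypothesis H : weyl_words A ev.
Variables (X J : {set 'I_n}).
Implicit Types (s t u v w g : seq 'I_n).
Local Notation len := (len ev).
Local Notation act := (lattice_act A).
Local Notation cact := (lattice_act A^T).
Local Notation e := (@unit_row n).

Let A2 i : A i i = 2. Proof. by case: (weyl_cartan H). Qed.

Lemma len_cons s j : len (j :: s) = len (rev s ++ [:: j]).
Proof. by rewrite -(len_rev H (j :: s)) rev_cons -cats1. Qed.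

Lemma nonneg_left_ascent s j : nonneg (act (rev s) (e j)) -> len (j :: s) = (len s).+1.
Proof. by rewrite len_cons -(len_rev H s); apply: nonneg_ascent. Qed.

Lemma nonpos_left_descent s j :
  nonneg (- act (rev s) (e j)) -> len s = (len (j :: s)).+1.
Proof. by rewrite len_cons -(len_rev H s); apply: nonpos_descent. Qed.

Lemma left_ascent_nonneg s j : (len s <= len (j :: s))%N -> nonneg (act (rev s) (e j)).
Proof. by rewrite len_cons -(len_rev H s); apply: ascent_nonneg. Qed.

Lemma left_descent_nonpos s j :
  (len (j :: s) <= len s)%N -> nonneg (- act (rev s) (e j)).
Proof. by rewrite len_cons -(len_rev H s); apply: descent_nonpos. Qed.

Definition in_parabolic s := exists2 t, all (mem X) t & ev t = ev s.

(** Minimality expressed by signs of roots instead of lengths; [min_coset_repE] links the two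
    forms. *)
Definition min_rep s :=
  in_parabolic s /\ forall b, b \in J -> nonneg (act s (e b)).

Lemma in_parabolic_ev s t : ev s = ev t -> in_parabolic s -> in_parabolic t.
Proof. by move=> st [u uX us]; exists u; rewrite // us. Qed.

Lemma min_rep_ev s t : ev s = ev t -> min_rep s -> min_rep t.
Proof.
move=> st [sX sJ]; split; first exact: in_parabolic_ev st sX.
by move=> b bJ; rewrite -(weyl_root H st); apply: sJ.
Qed.

Lemma in_parabolic_cat s t : in_parabolic s -> in_parabolic t -> in_parabolic (s ++ t).
Proof.
move=> [s' s'X s's] [t' t'X t't]; exists (s' ++ t'); first by rewrite all_cat s'X.
exact: (weyl_cat H).
Qed.

Lemma in_parabolic_rev s : in_parabolic s -> in_parabolic (rev s).
Proof. by move=> [t tX ts]; exists (rev t); rewrite ?all_rev //; apply: (ev_rev H). Qed.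

Lemma in_parabolic_cons j s : j \in X -> in_parabolic s -> in_parabolic (j :: s).
Proof.
move=> jX [t tX ts]; exists (j :: t); first by rewrite /= jX.
exact: (ev_catl H [:: j]).
Qed.

Lemma act_outside s x j : in_parabolic s -> j \notin X -> act s x 0 j = x 0 j.
Proof.
move=> [t tX ts] jX; rewrite -(weyl_root H ts) => {s ts}.
elim: t tX => //= i t IH /andP[iX tX]; rewrite lattice_reflE IH //.
by case: eqVneq => [ij|_]; [rewrite -ij iX in jX | rewrite mul0r subr0].
Qed.

(** For [j] outside [X], the inverse of [s] keeps the coordinate of [alpha_j] at [j] equal to 1, so
    the image cannot be negative. *)
Lemma left_descent_in s j : in_parabolic s -> (len (j :: s) <= len s)%N -> j \in X.
Proof.
move=> sX /left_descent_nonpos/(_ j); apply: contraLR => jX.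
by rewrite mxE act_outside ?unit_rowE ?eqxx //; apply: in_parabolic_rev.
Qed.

(** If [v] made [alpha_b] negative while [s_j v] keeps it positive, then [v alpha_b = - alpha_j],
    and [v^-1 alpha_j] would be negative although [s_j] lengthens [v]. *)
Lemma min_rep_lower j v : len (j :: v) = (len v).+1 -> min_rep (j :: v) -> min_rep v.
Proof.
move=> len_jv [jvX jvJ].
have jX : j \in X.
  by apply: left_descent_in jvX _; rewrite (len_eq (ev_iil H j v)) len_jv.
split; first by apply: in_parabolic_ev (ev_iil H j v) _; apply: in_parabolic_cons.
move=> b bJ; case: (root_sign H v b) => // neg_vb.
have vbE := act_rcons_self H v b; rewrite -vbE in neg_vb.
have ej : act (v ++ [:: b]) (e b) = e j.
  apply: (root_refl_neg A2) => //; rewrite vbE linearN opprK /=.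
  exact: jvJ b bJ.
have: nonneg (act (rev v) (e j)) by apply: left_ascent_nonneg; rewrite len_jv.
rewrite -ej vbE linearN /= lattice_actK // => /(_ b).
by rewrite mxE unit_rowE eqxx.
Qed.

(** Both hypotheses express the squares of the distributive lattice [W^J]; [quotient_up_commute] and
    [quotient_down_commute] discharge them. *)
Hypothesis up_commute : forall (z : seq 'I_n) (a b : 'I_n), a != b ->
  min_rep (a :: z) -> min_rep (b :: z) ->
  len (a :: z) = (len z).+1 -> len (b :: z) = (len z).+1 -> A a b = 0.
Hypothesis down_commute : forall (y : seq 'I_n) (a b : 'I_n), a != b -> min_rep y ->
  len y = (len (a :: y)).+1 -> len y = (len (b :: y)).+1 -> A a b = 0.

(* Left multiplication of [v] and [t v] by [s_j], where [alpha_j] is positive on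
   the coroot of [t], keeps them in the set of minimal representatives unless the
   root of [t] is [alpha_j], and shortens that coroot. *)
Lemma strong_cover_simple g i v :
  nonneg (act g (e i)) -> min_rep v -> min_rep (g ++ i :: rev g ++ v) ->
  len (g ++ i :: rev g ++ v) = (len v).+1 ->
  exists a, act g (e i) = e a.
Proof.
have [N] := ubnP (absz (\sum_j cact g (e i) 0 j)).
elim: N g v => // N IH g v; rewrite ltnS => ht_g.
set w := g ++ i :: rev g ++ v; set t := g ++ i :: rev g.
have wE : w = t ++ v by rewrite /w /t -catA.
set ga := act g (e i); set gv := cact g (e i) => pos_ga min_v min_w len_w.
have [/existsP[a /eqP ->]|nsimple] := boolP [exists a, ga == e a]; first by exists a.
have {}nsimple a : ga <> e a by move=> gaE; case/existsP: nsimple; exists a; apply/eqP.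
have pos_gv : nonneg gv by apply: (coroot_nonneg H).
(* The pairing of [gv] with [ga] is 2, so some simple root in the support of [ga] pairs positively
   with [gv]. *)
have [j ga_j c0] : exists2 j, ga 0 j != 0 & 0 < pairing A gv (e j).
  have: 0 < pairing A gv ga by rewrite pairing_act // pairing_unit A2.
  rewrite pairingE => sum_gt0.
  have [/existsP[j /andP[gaj cj]]|none] :=
    boolP [exists j, (ga 0 j != 0) && (0 < pairing A gv (e j))]; first by exists j.
  suff: \sum_j ga 0 j * pairing A gv (e j) <= 0 by rewrite leNgt sum_gt0.
  apply: sumr_le0 => j _; have [->|gaj] := eqVneq (ga 0 j) 0; first by rewrite mul0r.
  apply: mulr_ge0_le0; first exact: pos_ga.
  by rewrite leNgt; apply: contra none => cj; apply/existsP; exists j; rewrite gaj.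
set c := pairing A gv (e j) in c0.
have tE x : act t x = x - pairing A gv x *: ga by rewrite lattice_act_reflection.
(* The reflection [t = w v^-1] lies in the parabolic of [X] and negates [ga], so [ga] vanishes
   outside [X]. *)
have jX : j \in X.
  have tX : in_parabolic t.
    apply: (in_parabolic_ev _ (in_parabolic_cat min_w.1 (in_parabolic_rev min_v.1))).
    by have := ev_Krev H t v [::]; rewrite !cats0 wE -catA.
  have tga : act t ga = - ga.
    rewrite tE pairing_act // pairing_unit A2.
    by apply/rowP => k; rewrite !mxE; ring.
  apply: contraT => jX; have := act_outside ga tX jX.
  by rewrite tga mxE; move: (ga 0 j) ga_j => z; lia.
have rev_t : rev t = t by rewrite /t rev_cat rev_cons revK -cats1 -catA.
set be := act (rev v) ga.
have beE : be = act (rev v ++ g) (e i) by rewrite lattice_act_cat.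
have pos_be : nonneg be.
  rewrite beE; case: (root_sign H (rev v ++ g) i) => // neg_be.
  have := nonpos_reflection_len H (s := rev v) pos_ga.
  rewrite -lattice_act_cat => /(_ neg_be); rewrite -/t -rev_t -rev_cat -wE.
  by rewrite !(len_rev H) len_w; lia.
(* The signs of [dv] and [dw] tell whether [s_j] lengthens [v] and [w]. As [dw = dv - c be] with [c]
   and [be] positive, a negative [dv] forces a negative [dw]; three cases remain. *)
set dv := act (rev v) (e j); set dw := act (rev w) (e j).
have dwE : dw = dv - c *: be.
  by rewrite /dw wE rev_cat rev_t lattice_act_cat tE linearB linearZ.
pose g1 := j :: g.
have ga1E : act g1 (e i) = lattice_refl A j ga by [].
have pos_ga1 : nonneg (act g1 (e i)).
  case: (root_sign H g1 i) => // neg1; case: (@nsimple j).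
  exact: (root_refl_neg A2).
have ht_g1 : (absz (\sum_k cact g1 (e i) 0 k)%R < N)%N.
  have pos_gv1 := coroot_nonneg H pos_ga1.
  have sumE : \sum_k cact g1 (e i) 0 k = \sum_k gv 0 k - c.
    rewrite (eq_bigr (fun k => gv 0 k - (j == k)%:R * c)); last first.
      by move=> k _; rewrite lattice_act_cons lattice_reflE pairing_tr.
    rewrite sumrB; congr (_ - _); rewrite (bigD1 j) //= eqxx mul1r big1 ?addr0 //.
    by move=> k /negbTE; rewrite eq_sym => ->; rewrite mul0r.
  have ge1 : 0 <= \sum_k cact g1 (e i) 0 k by apply: sumr_ge0 => k _; apply: pos_gv1.
  move: ht_g ge1; rewrite sumE; move: (\sum_k gv 0 k) => S; lia.
have ev_w1 : ev (g1 ++ i :: rev g1 ++ j :: v) = ev (j :: w).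
  rewrite /g1 rev_cons -cats1 /= -!catA /=.
  by have := ev_ii H (j :: g ++ i :: rev g) j v; rewrite /= -!catA.
have IH1 : min_rep (j :: v) -> min_rep (j :: w) -> len (j :: w) = (len (j :: v)).+1 ->
    exists a, act g1 (e i) = e a.
  move=> mv mw len1; apply: (IH g1 (j :: v)) => //.
    exact: min_rep_ev (esym ev_w1) mw.
  by rewrite (len_eq ev_w1).
(* [a = j] would make [ga] negative; otherwise [s_j] fixes [alpha_a], hence [ga = alpha_a]. *)
have finish a : act g1 (e i) = e a -> (a != j -> A j a = 0) -> exists a, ga = e a.
  move=> ga1a Aja; exists a; have [aj|/Aja Aja0] := eqVneq a j.
    have : ga = - e j.
      by rewrite -[ga](lattice_reflK A2 j) -ga1E ga1a aj lattice_refl_self.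
    by move=> gaj; have := pos_ga j; rewrite gaj mxE unit_rowE eqxx.
  by rewrite -[ga](lattice_reflK A2 j) -ga1E ga1a commuting_refl.
have ev_ta a : act g1 (e i) = e a -> ev (j :: w) = ev (a :: j :: v).
  move=> /(reflection_of_simple_root H) /(ev_catr H (j :: v)).
  by rewrite -catA /= -ev_w1.
case: (root_sign H (rev v) j) => [pos_dv|neg_dv]; last first.
  (* Both elements descend: the lower pair stays in [W^J], and [v] and [s_j w] both cover
     [s_j v]. *)
  have neg_dw : nonneg (- dw).
    by rewrite dwE opprB addrC; apply: nonnegD => //; apply: nonnegZ => //; apply: ltW.
  have len_v1 := nonpos_left_descent neg_dv.
  have len_w1 := nonpos_left_descent neg_dw.
  have min_v1 : min_rep (j :: v).
    apply: (@min_rep_lower j); first by rewrite (len_eq (ev_iil H j v)).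
    exact: min_rep_ev (esym (ev_iil H j v)) min_v.
  have min_w1 : min_rep (j :: w).
    apply: (@min_rep_lower j); first by rewrite (len_eq (ev_iil H j w)).
    exact: min_rep_ev (esym (ev_iil H j w)) min_w.
  have [|a gaa] := IH1 min_v1 min_w1; first by lia.
  apply: (finish a gaa) => neaj; apply: (up_commute (z := j :: v)).
  - by rewrite eq_sym.
  - exact: min_rep_ev (esym (ev_iil H j v)) min_v.
  - exact: min_rep_ev (ev_ta _ gaa) min_w1.
  - by rewrite (len_eq (ev_iil H j v)).
  - by rewrite -(len_eq (ev_ta _ gaa)); lia.
have len_v1 := nonneg_left_ascent pos_dv.
case: (root_sign H (rev w) j) => [pos_dw|neg_dw]; last first.
  (* Here [v] ascends and [w] descends. By exchange, [v] arises from a reduced word of [w] starting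
     with [j] by deleting a letter: deleting that [j] gives [t = s_j], and keeping it contradicts
     the ascent of [v]. *)
  have [w' w'E sz_w'] := reduced_word ev (j :: w).
  have len_w1 := nonpos_left_descent neg_dw.
  have w'w : ev (j :: w') = ev w.
    by rewrite (ev_catl H [:: j] w'E) /= (ev_iil H).
  have neg_w : nonneg (- act (rev (j :: w')) ga).
    rewrite (weyl_root H (ev_rev H w'w)) wE rev_cat rev_t lattice_act_cat tE.
    rewrite pairing_act // pairing_unit A2 linearB linearZ /= -/be.
    by rewrite (_ : - _ = be) //; apply/rowP => k; rewrite !mxE; ring.
  have [s1 [b [s2 [revE]]]] := strong_exchange H pos_ga neg_w.
  rewrite -/t => evE.
  have {}evE : ev (rev v) = ev (s1 ++ s2).
    rewrite -evE (ev_catr H t (ev_rev H w'w)) wE rev_cat rev_t /t -!catA.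
    have := ev_Krev H (rev v) (g ++ i :: rev g) [::].
    by rewrite -/t rev_t /t !cats0 -!catA => ->.
  case/lastP: s2 => [|s2 k] in revE evE.
    case: (@nsimple j); rewrite cats0 in evE.
    move: revE; rewrite rev_cons -cats1 => /eqP.
    rewrite !cats1 eqseq_rcons => /andP[/eqP s1E _].
    have vw' : ev v = ev w' by have := ev_rev H evE; rewrite -s1E !revK.
    have tj : ev t = ev [:: j].
      apply: (ev_cancelr H (u := v)); rewrite -wE -w'w.
      by apply: (ev_catl H [:: j]); rewrite vw'.
    apply: (root_refl_neg A2) => //; have := weyl_root H tj ga; rewrite tE.
    rewrite pairing_act // pairing_unit A2 /= => <-.
    by rewrite (_ : - _ = ga) //; apply/rowP => l; rewrite !mxE; ring.
  move: revE; rewrite -rcons_cons -rcons_cat rev_cons => /eqP.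
  rewrite eqseq_rcons => /andP[/eqP revw' /eqP jk].
  have := ev_rev H evE; rewrite revK rev_cat rev_rcons -jk /= -rev_cat.
  move=> /(ev_catl H [:: j]); rewrite /= (ev_iil H) => /esym/len_min.
  rewrite size_rev -[size w']size_rev revw' /= in sz_w' *.
  by move: sz_w'; rewrite !size_cat /=; lia.
have len_w1 := nonneg_left_ascent pos_dw.
(* Both elements ascend. If [s_j v] left [W^J], then [v alpha_b = alpha_j] and
   [alpha_b = dw + c be], whence [be = alpha_b] and [ga = alpha_j]. *)
have min_v1 : min_rep (j :: v).
  split; first by apply: in_parabolic_cons min_v.1.
  move=> b bJ; case: (root_sign H (j :: v) b) => // neg_jvb.
  have vb : act v (e b) = e j by apply: (root_refl_neg A2) => //; apply: min_v.2.
  case: (@nsimple j); have dvb : dv = e b by rewrite /dv -vb lattice_actK.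
  rewrite -vb; apply: (can_inj (lattice_actK A2 (rev v))).
  rewrite lattice_actK // -/be beE; apply: (root_le_simple A2 (y := dw) c0).
  - by rewrite -beE.
  - exact: pos_dw.
  by rewrite -beE dwE dvb subrK.
(* Likewise [w alpha_b = alpha_j] would give [alpha_j = v alpha_b + c ga], whence [ga = alpha_j]. *)
have min_w1 : min_rep (j :: w).
  split; first by apply: in_parabolic_cons min_w.1.
  move=> b bJ; case: (root_sign H (j :: w) b) => // neg_jwb.
  have wb : act w (e b) = e j by apply: (root_refl_neg A2) => //; apply: min_w.2.
  case: (@nsimple j); apply: (root_le_simple A2 (y := act v (e b)) c0) => //.
    exact: min_v.2.
  have : act t (e j) = act v (e b).
    by rewrite -wb wE lattice_act_cat -{1}rev_t lattice_actK.
  by rewrite tE -/c => <-; rewrite subrK.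
have [|a gaa] := IH1 min_v1 min_w1; first by lia.
(* [s_j w] covers both [w] and [s_j v]. *)
apply: (finish a gaa) => neaj; apply: (down_commute (y := j :: w)) => //.
- by rewrite eq_sym.
- by rewrite (len_eq (ev_iil H j w)).
- have := ev_catl H [:: a] (ev_ta _ gaa); rewrite /= (ev_iil H) => /len_eq ->.
  by lia.
Qed.

End MinimalRepresentatives.

(** * Birkhoff representation *)

Section Birkhoff.
Variables (d : Order.disp_t) (L : distrLatticeType d) (es : seq L).
Local Open Scope order_scope.

(** The first clause excludes the bottom element without naming it. *)
Definition join_irreducible (x : L) :=
  has (fun a => ~~ (x <= a)) es &&
  all (fun a => all (fun b => (a `|` b == x) ==> (a == x) || (b == x)) es) es.

Definition irreducibles := {x : seq_sub es | join_irreducible (val x)}.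

HB.instance Definition _ := Finite.on irreducibles.

Definition irr_val (q : irreducibles) : L := val (val q).

Lemma irr_val_inj : injective irr_val.
Proof. by move=> p q /val_inj/val_inj. Qed.

Definition irr_le (p q : irreducibles) := irr_val p <= irr_val q.

Lemma irr_le_refl : reflexive irr_le. Proof. by move=> p; apply: lexx. Qed.
Lemma irr_le_anti : antisymmetric irr_le.
Proof. by move=> p q /le_anti/irr_val_inj. Qed.
Lemma irr_le_trans : transitive irr_le.
Proof. by move=> q p r; apply: le_trans. Qed.

HB.instance Definition _ := Order.Le_isPOrder.Build d irreducibles
  irr_le_refl irr_le_anti irr_le_trans.

Hypothesis es_full : forall x : L, x \in es.

Lemma irr_valP (x : L) : join_irreducible x -> exists q, irr_val q = x.
Proof. by move=> xP; exists (exist _ (SeqSub (es_full x)) xP). Qed.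

(** By distributivity [q] is the join of its meets with [a] and [b], so one of these meets is
    [q]. *)
Lemma irr_prime (q : irreducibles) a b :
  irr_val q <= a `|` b -> (irr_val q <= a) || (irr_val q <= b).
Proof.
move=> q_ab; have /andP[_ /allP/(_ _ (es_full (irr_val q `&` a)))] := valP q.
move=> /allP/(_ _ (es_full (irr_val q `&` b))).
by rewrite -meetUr (meet_idPl q_ab) eqxx /= !eq_meetl.
Qed.

(** Induction on the number of elements below [x]: an [x] that is neither irreducible nor the bottom
    is a join of two strictly smaller elements. *)
Lemma irr_dense x y : (forall q, irr_val q <= x -> irr_val q <= y) -> x <= y.
Proof.
have [k] := ubnP (count (fun z => z <= x) es).
elim: k x => // k IH x; rewrite ltnS => le_k below_x.
have lt_count a : a < x -> (count (fun z => z <= a)%O es < k)%N.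
  move=> a_x; apply: leq_trans le_k.
  have sub : subpred (fun z => z <= a) (fun z => z <= x).
    by move=> z /= za; apply: le_trans za (ltW a_x).
  have := es_full x; move: (es) => fs; elim: fs => // z fs IHfs.
  rewrite inE /= => /predU1P[<-|/IHfs lt_fs].
    by rewrite lexx (lt_geF a_x) add0n add1n ltnS; apply: sub_count.
  apply: leq_trans (_ : (z <= x)%O + (count (fun z => z <= a)%O fs).+1 <= _)%N.
    by rewrite addnS ltnS leq_add2r; case za: (z <= a) => //; rewrite (sub _ za).
  by rewrite leq_add2l.
have [/irr_valP[q qx]|] := boolP (join_irreducible x).
  by rewrite -qx; apply: below_x; rewrite qx.
rewrite negb_and => /orP[/hasPn bot_x|].
  by have := bot_x y (es_full y); rewrite negbK.
case/allPn => a _ /allPn[b _]; rewrite negb_imply negb_or => /and3P[/eqP abx nax nbx].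
have [ax bx] : a <= x /\ b <= x by rewrite -abx leUl leUr.
rewrite -abx leUx; apply/andP; split; apply: IH.
- by apply: lt_count; rewrite lt_def eq_sym nax.
- by move=> q qa; apply: below_x; apply: le_trans qa ax.
- by apply: lt_count; rewrite lt_def eq_sym nbx.
by move=> q qb; apply: below_x; apply: le_trans qb bx.
Qed.

Lemma lattice_bottom (x0 : L) : exists b : L, forall x, b <= x.
Proof.
exists (foldr Order.meet x0 es) => x; have := es_full x.
elim: es => //= z fs IH; rewrite inE => /predU1P[->|/IH le_x].
  exact: leIl.
exact: le_trans (leIr _ _) le_x.
Qed.

Definition below (x : L) : {set irreducibles} := [set q | irr_val q <= x].

Lemma birkhoff (x0 : L) :
  order_isomorphism (fun _ : L => True) (fun a b : L => a <= b)
    (@lower_ideal d irreducibles)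
    (fun X Y : {set irreducibles} => X \subset Y) below.
Proof.
have mono x y : x <= y <-> below x \subset below y.
  split=> [xy|/subsetP sub]; last by apply: irr_dense => q; have := sub q; rewrite !inE.
  by apply/subsetP => q; rewrite !inE => qx; apply: le_trans xy.
split=> //.
- move=> x _ p q; rewrite !inE => px qp.
  exact: le_trans (qp : irr_val q <= irr_val p) px.
- move=> x y _ _ eqxy; apply: le_anti; apply/andP.
  by split; apply/mono; rewrite eqxy.
move=> I0 idI0; have [b b_le] := lattice_bottom x0.
(* The ideal comes from the join of its members: by primality an irreducible below that join is
   below one of them. *)
exists (foldr Order.join b [seq irr_val q | q <- enum I0]) => //.
apply/setP => q; rewrite inE.
have -> : (q \in I0) = has (fun p => irr_val q <= irr_val p) (enum I0).
  apply/idP/hasP => [qI|[p]]; first by exists q; rewrite ?mem_enum.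
  by rewrite mem_enum => pI qp; apply: idI0 pI qp.
elim: (enum I0) => /= [|p s <-]; last first.
  apply/idP/idP => [/irr_prime //|/orP[]] h.
    exact: le_trans h (leUl _ _).
  exact: le_trans h (leUr _ _).
have /andP[/hasP[a _ qa] _] := valP q.
by apply: contraNF qa => /le_trans; apply.
Qed.

End Birkhoff.

(** * The Weyl group of a realization *)

Section Realization.
Variables (F : fieldType) (n : nat) (A : 'M[int]_n) (R : realization F A).
Hypotheses (charF0 : [pchar F] =i pred0) (gcmA : generalized_cartan_matrix A).
Local Notation h := (cartan R).
Local Notation alpha := (simple_root R).
Local Notation alphav := (simple_coroot R).
Local Notation wp := (@word_product F n A R).
Local Notation e := (@unit_row n).
Implicit Types (s t : seq 'I_n) (y : 'rV[int]_n).

Definition root_of (x : 'rV[int]_n) : 'Hom(h, F^o) :=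
  \sum_j (x 0 j)%:~R *: alpha j.
Definition coroot_of y : h := \sum_j (y 0 j)%:~R *: alphav j.

Lemma simple_reflectionE i (x : h) :
  simple_reflection R i x = x - (alpha i x : F) *: alphav i.
Proof. by rewrite lfunE. Qed.

Lemma word_product_cat s t : wp (s ++ t) = (wp s \o wp t)%VF.
Proof. by elim: s => /= [|i s ->]; rewrite ?comp_lfun1l // comp_lfunA. Qed.

Lemma word_product_cons i s (x : h) : wp (i :: s) x = simple_reflection R i (wp s x).
Proof. by rewrite /= comp_lfunE. Qed.

Lemma word_product_nil (x : h) : wp [::] x = x.
Proof. by rewrite /= id_lfunE. Qed.

Lemma simple_root_sub i j (x : h) (c : F) :
  alpha i (x - c *: alphav j) = alpha i x - c * (A j i)%:~R :> F.
Proof. by rewrite linearB linearZ /= simple_pairing. Qed.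

Lemma simple_reflectionK i : involutive (simple_reflection R i).
Proof.
move=> x; rewrite !simple_reflectionE simple_root_sub; case: gcmA => -> _ _.
rewrite -addrA -opprD -scalerDl [X in X *: _](_ : _ = 0) ?scale0r ?subr0 //.
by ring.
Qed.

Lemma word_product_revK s : cancel (wp s) (wp (rev s)).
Proof.
elim: s => [|i s IH] x; first by rewrite !word_product_nil.
rewrite rev_cons -cats1 word_product_cat comp_lfunE !word_product_cons.
by rewrite word_product_nil simple_reflectionK.
Qed.

Lemma word_product_Krev s : cancel (wp (rev s)) (wp s).
Proof. by move=> x; rewrite -{1}[s]revK word_product_revK. Qed.

Lemma word_product_inv s : (wp s)^-1%VF = wp (rev s).
Proof.
apply/lfunP => x; rewrite -{1}[x](word_product_Krev s) lker0_lfunK //.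
by apply/lker0P; apply: can_inj (word_product_revK s).
Qed.

Lemma intr_inj_char0 : injective (intr : int -> F).
Proof.
have natr0 m : (m%:R == 0 :> F) = (m == 0%N) by move/pcharf0P: charF0 => ->.
have int0 (z : int) : z%:~R = 0 :> F -> z = 0.
  case: z => m; first by rewrite -pmulrn => /eqP; rewrite natr0 => /eqP ->.
  by rewrite NegzE mulrNz => /eqP; rewrite oppr_eq0 -pmulrn natr0.
move=> a b /eqP; rewrite -subr_eq0 -mulrzBr => /eqP/int0/eqP.
by rewrite subr_eq0 => /eqP.
Qed.

Lemma coroot_of_linear a y z :
  coroot_of (a *: y + z) = a%:~R *: coroot_of y + coroot_of z.
Proof.
rewrite /coroot_of scaler_sumr -big_split /=; apply: eq_bigr => j _.
by rewrite !mxE intrD intrM scalerDl scalerA.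
Qed.

Lemma root_of_linear a y z : root_of (a *: y + z) = a%:~R *: root_of y + root_of z.
Proof.
rewrite /root_of scaler_sumr -big_split /=; apply: eq_bigr => j _.
by rewrite !mxE intrD intrM scalerDl scalerA.
Qed.

Lemma coroot_of_unit i : coroot_of (e i) = alphav i.
Proof.
rewrite /coroot_of (bigD1 i) //= unit_rowE eqxx scale1r big1 ?addr0 //.
by move=> j /negbTE ji; rewrite unit_rowE eq_sym ji scale0r.
Qed.

Lemma root_of_unit i : root_of (e i) = alpha i.
Proof.
rewrite /root_of (bigD1 i) //= unit_rowE eqxx scale1r big1 ?addr0 //.
by move=> j /negbTE ji; rewrite unit_rowE eq_sym ji scale0r.
Qed.

Lemma free_int_inj (V : vectType F) (v : 'I_n -> V) :
  free [seq v i | i : 'I_n] ->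
  forall x y : 'rV[int]_n,
  \sum_j (x 0 j)%:~R *: v j = \sum_j (y 0 j)%:~R *: v j -> x = y.
Proof.
move=> free_v x y eqxy; apply/rowP => j; apply: intr_inj_char0.
have /freeP freeE : free [tuple v i | i < n] by exact: free_v.
apply/eqP; rewrite -subr_eq0; apply/eqP.
apply: (freeE (fun k => (x 0 k)%:~R - (y 0 k)%:~R)).
rewrite (eq_bigr (fun k => (x 0 k)%:~R *: v k - (y 0 k)%:~R *: v k)).
  by rewrite sumrB eqxy subrr.
by move=> k _; rewrite scalerBl -tnth_nth tnth_mktuple.
Qed.

Lemma coroot_of_inj : injective coroot_of.
Proof. exact: free_int_inj (simple_coroot_free R). Qed.

Lemma root_of_inj : injective root_of.
Proof. exact: free_int_inj (simple_root_free R). Qed.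

Lemma simple_root_coroot_of i y : alpha i (coroot_of y) = (pairing A y (e i))%:~R :> F.
Proof.
rewrite -pairing_tr pairingE rmorph_sum linear_sum; apply: eq_bigr => j _.
by rewrite linearZ /= simple_pairing pairing_tr pairing_unit intrM.
Qed.

Lemma root_of_simple_coroot i x : root_of x (alphav i) = (pairing A (e i) x)%:~R :> F.
Proof.
rewrite pairingE rmorph_sum sum_lfunE; apply: eq_bigr => j _.
by rewrite scale_lfunE simple_pairing pairing_unit /= intrM.
Qed.

Lemma coroot_of_act s y : coroot_of (lattice_act A^T s y) = wp s (coroot_of y).
Proof.
elim: s => [|i s IH]; first by rewrite word_product_nil.
rewrite word_product_cons -IH simple_reflectionE simple_root_coroot_of.
rewrite lattice_act_cons /lattice_refl -scaleNr addrC coroot_of_linear.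
by rewrite coroot_of_unit pairing_tr addrC mulrNz scaleNr.
Qed.

Lemma root_of_act s x (z : h) :
  root_of (lattice_act A s x) z = root_of x (wp (rev s) z).
Proof.
elim: s z => [|i s IH] z; first by rewrite word_product_nil.
rewrite rev_cons -cats1 word_product_cat comp_lfunE word_product_cons word_product_nil.
rewrite -IH simple_reflectionE linearB linearZ /= root_of_simple_coroot.
rewrite /lattice_refl -scaleNr addrC root_of_linear root_of_unit.
by rewrite add_lfunE scale_lfunE addrC mulrNz scaleNr; congr (_ - _); apply: mulrC.
Qed.

Lemma word_product_rev s t : wp s = wp t -> wp (rev s) = wp (rev t).
Proof. by rewrite -!word_product_inv => ->. Qed.

(** Both words change [x] only by multiples of the two coroots; tracking these coefficients turns
    each relation into an identity in [F] for every possible pair of Cartan entries. *)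
Lemma word_product_braid i j m : i != j ->
    (A i j * A j i, m) \in [:: (0, 2%N); (1, 3); (2, 4); (3, 6)] ->
    wp (alt_word i j m) = wp (alt_word j i m).
Proof.
move=> neij bond; apply/lfunP => x.
pose c P Q : h := x - P *: alphav i - Q *: alphav j.
pose X : F := alpha i x; pose Y : F := alpha j x.
case: gcmA => A2 Ale A0.
have ci P Q : simple_reflection R i (c P Q) = c (X - P - (A j i)%:~R * Q) Q.
  rewrite simple_reflectionE !simple_root_sub A2 /c.
  rewrite addrAC; congr (_ - _); rewrite -addrA -opprD -scalerDl; congr (_ - _ *: _).
  by rewrite -/X; ring.
have cj P Q : simple_reflection R j (c P Q) = c P (Y - Q - (A i j)%:~R * P).
  rewrite simple_reflectionE !simple_root_sub A2 /c.
  rewrite -addrA -opprD -scalerDl; congr (_ - _ *: _).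
  by rewrite -/Y; ring.
have c0 : x = c 0 0 by rewrite /c !scale0r !subr0.
have [ij0 ji0] : A i j <= 0 /\ A j i <= 0 by rewrite !Ale // eq_sym.
have Aij_range : 0 < A i j * A j i <= 3 ->
    [\/ A i j = -1, A i j = -2 | A i j = -3].
  move=> /andP[gt0 le3]; have ji1 : A j i <= -1 by nia.
  have [ij1 ij3] : A i j <= -1 /\ -3 <= A i j by nia.
  have : A i j = -1 \/ A i j = -2 \/ A i j = -3 by lia.
  by case=> [|[]]; [constructor 1 | constructor 2 | constructor 3].
move: bond; rewrite !inE !xpair_eqE => /or4P[] /andP[/eqP prod /eqP ->].
- have [Aij Aji] : A i j = 0 /\ A j i = 0.
    by have /eqP := prod; rewrite mulf_eq0 => /orP[]/eqP zero; split=> //; apply: A0.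
  rewrite !word_product_cons word_product_nil c0 !(ci, cj) Aij Aji.
  by congr c; ring.
- have [Aij Aji] : A i j = -1 /\ A j i = -1.
    by have := Aij_range; rewrite prod => /(_ isT)[] Aij; move: prod; rewrite Aij; lia.
  rewrite !word_product_cons word_product_nil c0 !(ci, cj) Aij Aji.
  by congr c; ring.
- have disj : (A i j = -1 /\ A j i = -2) \/ (A i j = -2 /\ A j i = -1).
    by have := Aij_range; rewrite prod => /(_ isT)[] Aij; move: prod; rewrite Aij; lia.
  case: disj => [] [Aij Aji];
    rewrite !word_product_cons word_product_nil c0 !(ci, cj) Aij Aji;
    by congr c; ring.
- have disj : (A i j = -1 /\ A j i = -3) \/ (A i j = -3 /\ A j i = -1).
    by have := Aij_range; rewrite prod => /(_ isT)[] Aij; move: prod; rewrite Aij; lia.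
  case: disj => [] [Aij Aji];
    rewrite !word_product_cons word_product_nil c0 !(ci, cj) Aij Aji;
    by congr c; ring.
Qed.

(** Equal endomorphisms act equally on both lattices because the simple roots and the simple coroots
    are free in characteristic zero. *)
Lemma realization_weyl_words : weyl_words A wp.
Proof.
split=> //.
- by move=> s s' t t' ss tt; rewrite !word_product_cat ss tt.
- move=> i; apply/lfunP => x.
  by rewrite !word_product_cons simple_reflectionK.
- exact: word_product_braid.
- move=> s t st x; apply: root_of_inj; apply/lfunP => z.
  by rewrite !root_of_act (word_product_rev st).
by move=> s t st y; apply: coroot_of_inj; rewrite !coroot_of_act st.
Qed.

End Realization.

(** * Covers and squares *)

Section LatticeCovers.
Variables (d : Order.disp_t) (L : distrLatticeType d).
Implicit Types x y z m t : L.
Local Open Scope order_scope.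

Definition lattice_cover x y :=
  x < y /\ forall t, x <= t -> t <= y -> t = x \/ t = y.

(** By distributivity, [t] between [x] and the join is the join of [x] with the meet of [t] and [y];
    that meet lies between [z] and [y]. *)
Lemma join_cover z x y : lattice_cover z x -> lattice_cover z y -> x <> y ->
  lattice_cover x (x `|` y).
Proof.
move=> [zx covx] [zy covy] nexy; split=> [|t xt txy].
  rewrite lt_def leUl andbT; apply/eqP => /join_idPl yx.
  by case: (covx y (ltW zy) yx) => [yz|/esym//]; rewrite yz ltxx in zy.
have -> : t = x `|` (t `&` y).
  by rewrite -{1}(meet_idPl txy) meetUr (meet_idPr xt).
case: (covy (t `&` y)) => [||->|->]; last by right.
- by rewrite lexI (le_trans (ltW zx) xt) ltW.
- exact: leIr.
by left; apply/join_idPl/ltW.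
Qed.

Lemma meet_cover m x y : lattice_cover x m -> lattice_cover y m -> x <> y ->
  lattice_cover (x `&` y) x.
Proof.
move=> [xm covx] [ym covy] nexy; split=> [|t xyt tx].
  rewrite lt_def leIl andbT; apply/eqP => /esym/meet_idPl xy.
  by case: (covx y xy (ltW ym)) => [/esym//|ymE]; rewrite ymE ltxx in ym.
have -> : t = x `&` (t `|` y).
  by rewrite meetUr (meet_idPr tx) (join_idPl xyt).
case: (covy (t `|` y)) => [||->|->]; first 1 last.
- by rewrite leUx (le_trans tx (ltW xm)) ltW.
- by left.
- by right; apply/meet_idPl/ltW.
exact: leUr.
Qed.

End LatticeCovers.

Section Covers.
Variables (T : Type) (D : T -> Prop) (le : T -> T -> Prop).
Variables (d : Order.disp_t) (L : distrLatticeType d) (f : T -> L).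
Hypothesis iso : order_isomorphism D le (fun _ => True) (fun a b : L => (a <= b)%O) f.

Lemma iso_cover x y : D x -> D y ->
  covers_on D le x y <-> lattice_cover (f x) (f y).
Proof.
case: iso => _ f_inj f_surj f_le Dx Dy; split.
  move=> [_ _ /f_le xy nexy cov]; split=> [|t].
    rewrite lt_def xy // andbT; by apply/eqP => /esym/(f_inj _ _ Dx Dy).
  have [z Dz <-] := f_surj t I; move=> /(f_le _ _ Dx Dz) xz /(f_le _ _ Dz Dy) zy.
  by case: (cov z Dz xz zy) => ->; [left|right].
move=> [/[dup] /ltW/f_le xy /lt_eqF/eqP nexy cov]; split=> //; first exact: xy.
  by move=> exy; apply: nexy; rewrite exy.
move=> z Dz /(f_le _ _ Dx Dz) xz /(f_le _ _ Dz Dy) zy.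
by case: (cov (f z) xz zy) => /f_inj h; [left|right]; apply: h.
Qed.

Lemma upper_square z x y : covers_on D le z x -> covers_on D le z y -> x <> y ->
  exists m, covers_on D le x m /\ covers_on D le y m.
Proof.
move=> /[dup] [[Dz Dx _ _ _]] /iso_cover cx /[dup] [[_ Dy _ _ _]] /iso_cover cy nexy.
case: iso => _ f_inj f_surj f_le.
have [m Dm fm] := f_surj (f x `|` f y)%O I.
have nefxy : f x <> f y by move/f_inj => h; apply: nexy; apply: h.
exists m; split; apply/iso_cover => //; rewrite fm.
  by apply: (join_cover (z := f z)); [apply: cx|apply: cy|].
rewrite joinC; apply: (join_cover (z := f z)); [exact: cy|exact: cx|].
by move/esym.
Qed.

Lemma lower_square m x y : covers_on D le x m -> covers_on D le y m -> x <> y ->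
  exists z, covers_on D le z x /\ covers_on D le z y.
Proof.
move=> /[dup] [[Dx Dm _ _ _]] /iso_cover cx /[dup] [[Dy _ _ _ _]] /iso_cover cy nexy.
case: iso => _ f_inj f_surj f_le.
have [z Dz fz] := f_surj (f x `&` f y)%O I.
have nefxy : f x <> f y by move/f_inj => h; apply: nexy; apply: h.
exists z; split; apply/iso_cover => //; rewrite fz.
  by apply: (meet_cover (m := f m)); [apply: cx|apply: cy|].
rewrite meetC; apply: (meet_cover (m := f m)); [exact: cy|exact: cx|].
by move/esym.
Qed.

End Covers.

Lemma finite_maximal_above (d : Order.disp_t) (Q : finPOrderType d)
    (I0 : {set Q}) (p : Q) :
  p \in I0 -> exists2 r, maximal_in I0 r & (p <= r)%O.
Proof.
move=> pI; pose P r := (r \in I0) && (p <= r)%O.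
have Pp : P p by rewrite /P pI lexx.
(* An element above [p] with the largest principal ideal is maximal. *)
case: (arg_maxnP (fun r => #|[set z : Q | (z <= r)%O]|) Pp) => r /andP[rI pr] rmax.
exists r => //; split=> // x xI rx; apply: le_anti; rewrite rx andbT.
have Px : P x by rewrite /P xI (le_trans pr rx).
have sub : [set z : Q | (z <= r)%O] \subset [set z : Q | (z <= x)%O].
  by apply/subsetP => z; rewrite !inE => zr; apply: le_trans rx.
have /eqP/setP/(_ x) : [set z : Q | (z <= r)%O] == [set z : Q | (z <= x)%O].
  by rewrite eqEcard sub; apply: rmax.
by rewrite !inE lexx.
Qed.

Lemma lower_idealD1 (d : Order.disp_t) (Q : finPOrderType d) (I0 : {set Q}) (q : Q) :
  lower_ideal I0 -> maximal_in I0 q -> lower_ideal (I0 :\ q).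
Proof.
move=> idI [_ qmax] x y; rewrite !inE => /andP[nexq xI] yx.
rewrite (idI x y xI yx) andbT; apply: contraNneq nexq => yq.
by apply/eqP; apply: qmax => //; rewrite -yq.
Qed.

Lemma maximal_inD1 (d : Order.disp_t) (Q : finPOrderType d) (I0 : {set Q}) (p q : Q) :
  p != q -> maximal_in I0 p -> maximal_in (I0 :\ q) p.
Proof.
move=> nepq [pI pmax]; split; first by rewrite !inE nepq.
by move=> x; rewrite !inE => /andP[_ xI]; apply: pmax.
Qed.

(** * Labels constant along squares of ideals *)

Section SquareLabels.
Variables (T S : Type) (D : T -> Prop) (le : T -> T -> Prop).
Variables (d : Order.disp_t) (Q : finPOrderType d) (f : T -> {set Q}).
Hypothesis iso : order_isomorphism D le (@lower_ideal d Q)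
  (fun X Y : {set Q} => X \subset Y) f.

Lemma ideal_cover (I0 : {set Q}) q x y : q \in I0 -> D x -> D y ->
  f x = I0 :\ q -> f y = I0 -> covers_on D le x y.
Proof.
case: iso => _ f_inj _ f_le qI Dx Dy fx fy; split=> //.
- by apply/f_le => //; rewrite fx fy subD1set.
- by move=> xy; move: fx; rewrite xy fy => /setP/(_ q); rewrite !inE qI eqxx.
move=> z Dz /f_le xz /f_le zy; have {}xz := xz Dx Dz; have {}zy := zy Dz Dy.
rewrite fx in xz; rewrite fy in zy.
have [qz|qz] := boolP (q \in f z).
  right; apply: f_inj => //; rewrite fy; apply/eqP; rewrite eqEsubset zy /=.
  apply/subsetP => p pI; have [->//|neq] := eqVneq p q.
  by apply: (subsetP xz); rewrite !inE neq.
left; apply: f_inj => //; rewrite fx; apply/eqP; rewrite eqEsubset xz andbT.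
apply/subsetP => p pz; rewrite !inE (subsetP zy _ pz) andbT.
by apply: contraNneq qz => <-.
Qed.

Variable edge : T -> T -> S -> Prop.
Hypothesis cover_edge : forall x y, covers_on D le x y -> exists l, edge x y l.
Hypothesis square_edge : forall z x y m l1 l2 l3 l4, x <> y ->
  edge z x l1 -> edge z y l2 -> edge x m l3 -> edge y m l4 -> l3 = l2.

(* Any edge removing [q] is joined by a chain of squares to the one whose top is
   the principal ideal of [q]. *)
Lemma square_labels q : exists l, forall I0 x y,
  lower_ideal I0 -> maximal_in I0 q -> D x -> D y ->
  f x = I0 :\ q -> f y = I0 -> edge x y l.
Proof.
case: (iso) => _ f_inj f_surj _.
pose P0 := [set p : Q | (p <= q)%O].
have idP0 : lower_ideal P0.
  by move=> x y; rewrite !inE => xq yx; apply: le_trans xq.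
have maxP0 : maximal_in P0 q.
  split=> [|x]; first by rewrite inE lexx.
  by rewrite inE => xq qx; apply: le_anti; rewrite xq.
have [y0 Dy0 fy0] := f_surj _ idP0.
have [x0 Dx0 fx0] := f_surj _ (lower_idealD1 idP0 maxP0).
have [l edge0] := cover_edge (ideal_cover maxP0.1 Dx0 Dy0 fx0 fy0).
exists l => I0; have [k] := ubnP #|I0|; elim: k I0 => // k IH I0.
rewrite ltnS => card_k x y idI maxI Dx Dy fx fy.
have subP0 : P0 \subset I0.
  by apply/subsetP => p; rewrite inE => pq; apply: idI maxI.1 pq.
have [eqP0|neP0] := eqVneq I0 P0.
  have -> : x = x0 by apply: f_inj => //; rewrite fx fx0 eqP0.
  by have -> : y = y0 by apply: f_inj => //; rewrite fy fy0 eqP0.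
have [p1 p1I p1q] : exists2 p1, p1 \in I0 & ~~ (p1 <= q)%O.
  have /subsetPn[p pI] : ~~ (I0 \subset P0).
    by apply: contra neP0 => sub; rewrite eqEsubset sub.
  by rewrite inE => pq; exists p.
(* A second maximal element [p] can be removed too: [x'], [x], [y'], [y] form a square, and
   induction on [I0 :\ p] labels the side opposite to the cover of [x] by [y]. *)
have [p maxp p1p] := finite_maximal_above p1I.
have nepq : p != q by apply: contraNneq p1q => <-.
have neqp : q != p by rewrite eq_sym.
have idIp := lower_idealD1 idI maxp; have maxIp := maximal_inD1 neqp maxI.
have [y' Dy' fy'] := f_surj _ idIp.
have [x' Dx' fx'] := f_surj _ (lower_idealD1 idIp maxIp).
have edge' : edge x' y' l.
  by apply: (IH (I0 :\ p)) => //; move: card_k; rewrite (cardsD1 p I0) maxp.1.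
have [l1 edge_x'x] : exists l1, edge x' x l1.
  apply: cover_edge; apply: (@ideal_cover (I0 :\ q) p) => //.
    by rewrite !inE nepq maxp.1.
  by rewrite fx' !setDDl setUC.
have [l3 edge_xy] : exists l3, edge x y l3.
  by apply: cover_edge; apply: (ideal_cover maxI.1).
have [l4 edge_y'y] : exists l4, edge y' y l4.
  by apply: cover_edge; apply: (ideal_cover maxp.1).
have nexy' : x <> y'.
  by move=> exy; move: fx; rewrite exy fy' => /setP/(_ p); rewrite !inE nepq eqxx maxp.1.
by rewrite -(square_edge nexy' edge_x'x edge' edge_xy edge_y'y).
Qed.

End SquareLabels.

Lemma clos_refl_trans_sub (T : Type) (r1 r2 : T -> T -> Prop) :
  (forall x y, r1 x y -> clos_refl_trans T r2 x y) ->
  forall x y, clos_refl_trans T r1 x y -> clos_refl_trans T r2 x y.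
Proof.
move=> sub x y; elim=> [a b /sub //|a|a b c _ ab _ bc]; first exact: rt_refl.
exact: rt_trans ab bc.
Qed.

(** The square condition concerns a finer label in [S], from which [value] reads the multiplicity,
    so that one argument serves both graphs. *)
Lemma squares_dll (T : eqType) (S : Type) (D : T -> Prop) (le : T -> T -> Prop)
    (lab : T -> T -> nat -> Prop) (edge : T -> T -> S -> Prop) (value : S -> nat)
    (ts : seq T) (x0 : T) :
  D x0 -> (forall x, D x -> x \in ts) ->
  partial_order_on D le ->
  is_distributive_lattice D le ->
  (forall x y, D x -> D y -> (le x y <-> induced_graph_le D lab x y)) ->
  (forall x y, covers_on D le x y -> exists l, edge x y l) ->
  (forall z x y m l1 l2 l3 l4, x <> y ->
    edge z x l1 -> edge z y l2 -> edge x m l3 -> edge y m l4 -> l3 = l2) ->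
  (forall x y l, D x -> D y -> edge x y l -> lab x y (value l)) ->
  (forall x y m, D x -> D y -> lab x y m -> covers_on D le x y) ->
  (forall x y m m', D x -> D y -> lab x y m -> lab x y m' -> m = m') ->
  induced_graph_is_dll D lab.
Proof.
move=> Dx0 Dts [le_refl le_anti' le_trans'] [d [L [f iso]]] leE cov_edge square.
move=> edge_lab lab_cov lab_uniq.
have covE x y : covers_on D le x y <-> covers_on D (induced_graph_le D lab) x y.
  split=> [[Dx Dy xy nexy cov]|[Dx Dy xy nexy cov]]; split=> //.
  - exact/leE.
  - by move=> z Dz xz zy; apply: cov => //; apply/leE.
  - exact/leE.
  by move=> z Dz xz zy; apply: cov => //; apply/leE.
split.
  split=> [|x y m Dx Dy labm|x y /covE cov].
  - split=> [x Dx|x y Dx Dy xy yx|x y z Dx Dy Dz xy yz].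
    + exact: rt_refl.
    + by apply: le_anti' => //; apply/leE.
    exact: rt_trans xy yz.
  - by apply/covE; apply: lab_cov labm.
  have [Dx Dy _ _ _] := cov.
  have [l exy] := cov_edge x y cov; exists (value l); split.
    exact: edge_lab.
  by move=> m'; apply: lab_uniq => //; apply: edge_lab.
case: (iso) => _ f_inj f_surj f_le.
have es_full z : z \in [seq f x | x <- ts].
  by have [x Dx <-] := f_surj z I; apply: map_f; apply: Dts.
have [b_id b_inj b_surj b_le] := birkhoff es_full (f x0).
pose g x := below [seq f x | x <- ts] (f x).
have iso_g : order_isomorphism D le (@lower_ideal d (irreducibles [seq f x | x <- ts]))
    (fun X Y => X \subset Y) g.
  split.
  - by move=> x _; apply: b_id.
  - by move=> x y Dx Dy /b_inj eqf; apply: f_inj => //; apply: eqf.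
  - by move=> z /b_surj [u _ <-]; have [x Dx <-] := f_surj u I; exists x.
  move=> x y Dx Dy; split=> [/f_le xy|/b_le xy].
    by apply/b_le => //; apply: xy.
  by apply/f_le => //; apply: xy.
have [p pE] := fin_all_exists (square_labels iso_g cov_edge square).
exists d, (irreducibles [seq f x | x <- ts]), g, (fun q => value (p q)); split.
  case: iso_g => g_id g_inj g_surj g_le; split=> // x y Dx Dy.
  by split=> [/leE xy|/g_le xy]; [apply/g_le => //; apply: xy | apply/leE => //; apply: xy].
move=> I0 q x y idI maxI Dx Dy gx gy; apply: edge_lab => //.
exact: pE idI maxI Dx Dy gx gy.
Qed.

(** * The parabolic quotient *)

Section CosetLength.
Variables (n : nat) (A : 'M[int]_n) (G : eqType) (ev : seq 'I_n -> G).
Hypothesis H : weyl_words A ev.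
Variable J : {set 'I_n}.
Implicit Types (s t u v : seq 'I_n).
Local Notation len := (len ev).
Local Notation act := (lattice_act A).
Local Notation e := (@unit_row n).

Let A2 i : A i i = 2. Proof. by case: (weyl_cartan H). Qed.

(** The minimum runs over words in [J] only, a class stable under the letter deletions of the
    exchange condition. *)
Lemma parabolic_minimal_word u : all (mem J) u ->
  exists t, [/\ all (mem J) t, ev t = ev u
    & forall t', all (mem J) t' -> ev t' = ev u -> (size t <= size t')%N].
Proof.
move=> uJ.
have ex : exists m, [exists t : m.-tuple 'I_n, all (mem J) t && (ev t == ev u)].
  by exists (size u); apply/existsP; exists (in_tuple u); rewrite /= uJ eqxx.
case: (ex_minnP ex) => m /existsP[t /andP[tJ /eqP tu]] mmin.
exists t; split=> // t' t'J t'u; rewrite size_tuple; apply: mmin.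
by apply/existsP; exists (in_tuple t'); rewrite /= t'J t'u eqxx.
Qed.

Lemma nonneg_parabolic s u b : (forall b, b \in J -> nonneg (act s (e b))) ->
  all (mem J) u -> b \in J -> nonneg (act u (e b)) -> nonneg (act s (act u (e b))).
Proof.
move=> sJ uJ bJ pos_u.
have outside k : k \notin J -> act u (e b) 0 k = 0.
  move=> kJ; rewrite (act_outside H (X := J)) //; last by exists u.
  by rewrite unit_rowE; case: eqVneq => // bk; rewrite -bk bJ in kJ.
rewrite [act u (e b)]row_sum_delta linear_sum => j; rewrite summxE sumr_ge0 // => k _.
rewrite linearZ mxE; have [kJ|/outside ->] := boolP (k \in J); last by rewrite mul0r.
by apply: mulr_ge0; [apply: pos_u | apply: sJ].
Qed.

(** Along a shortest word in [J], each prefix sends the next simple root to a positive root, since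
    exchange would otherwise shorten the word. As [s] keeps this root positive, each letter
    lengthens the product. *)
Lemma len_min_coset s u : (forall b, b \in J -> nonneg (act s (e b))) ->
  all (mem J) u -> (len s <= len (s ++ u))%N.
Proof.
move=> sJ uJ; have [t [tJ tu tmin]] := parabolic_minimal_word uJ.
rewrite -(len_eq (ev_catl H s tu)).
have {u uJ tu}tmin t' : all (mem J) t' -> ev t' = ev t -> (size t <= size t')%N.
  by rewrite tu; apply: tmin.
elim/last_ind: t tJ tmin => [|t b IH] tbJ tmin; first by rewrite cats0.
move: (tbJ); rewrite all_rcons => /andP[bJ tJ].
apply: leq_trans (IH tJ _) _.
  move=> t' t'J t't; rewrite -ltnS -!(size_rcons _ b); apply: tmin.
    by rewrite all_rcons bJ.
  by rewrite -!cats1; apply: (ev_catr H).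
have pos_t : nonneg (act t (e b)).
  case: (root_sign H t b) => // neg_t.
  have [s1 [c [s2 [tE]]]] := strong_exchange H (g := [::]) (unit_row_nonneg b) neg_t.
  rewrite /= cats1 => /esym/tmin; rewrite tE size_rcons !size_cat /=.
  suff s12J : all (mem J) (s1 ++ s2) by move=> /(_ s12J); lia.
  by move: tJ; rewrite tE !all_cat /= => /and3P[-> _ ->].
rewrite -cats1 catA (nonneg_ascent H) // lattice_act_cat.
exact: nonneg_parabolic.
Qed.

End CosetLength.

(** * Left weak order on [W^J] and the labels of its covers *)

Section Quotient.
Variables (F : fieldType) (n : nat) (A : 'M[int]_n) (R : realization F A).
Hypotheses (charF0 : [pchar F] =i pred0) (gcmA : generalized_cartan_matrix A).
Variables (X J : {set 'I_n}).
Local Notation h := (cartan R).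
Local Notation alpha := (simple_root R).
Local Notation alphav := (simple_coroot R).
Local Notation wp := (@word_product F n A R).
Local Notation len := (len wp).
Local Notation act := (lattice_act A).
Local Notation cact := (lattice_act A^T).
Local Notation e := (@unit_row n).
Local Notation D := (min_coset_rep (R := R) X J).
Local Notation lw := (left_weak_le (R := R)).
Local Arguments word_product : simpl never.
Implicit Types (s t : seq 'I_n) (x y z : 'End(h)).

Let H : weyl_words A wp := realization_weyl_words R charF0 gcmA.
Let A2 i : A i i = 2. Proof. by case: gcmA. Qed.

Lemma has_lengthE s l : has_length (wp s) l <-> l = len s.
Proof.
split=> [[[t <- st] lmin]|->].
  have [u us sz_u] := reduced_word wp s.
  apply/eqP; rewrite eqn_leq -{1}sz_u lmin //=; exact: len_min.
split; first by have [u us sz_u] := reduced_word wp s; exists u.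
by move=> t st; apply: len_min.
Qed.

Lemma weyl_word s : weyl_group (wp s).
Proof. by exists s => //; apply/allP => i _; rewrite /= inE. Qed.

Lemma left_weak_coverE j s y :
  left_weak_cover j (wp s) y <-> y = wp (j :: s) /\ len (j :: s) = (len s).+1.
Proof.
split=> [[_ yE [l]]|[-> len_js]].
  by rewrite yE -[(_ \o _)%VF]/(wp (j :: s)) => /has_lengthE -> /has_lengthE.
by split=> //; [exact: weyl_word | exists (len s); apply/has_lengthE].
Qed.

Lemma left_weak_cover_word j x y : left_weak_cover j x y ->
  exists s, [/\ x = wp s, y = wp (j :: s) & len (j :: s) = (len s).+1].
Proof.
move=> /[dup] [[[s _ xE] _ _]]; rewrite xE => /left_weak_coverE[-> len_js].
by exists s.
Qed.

Lemma min_coset_rep_word x : D x -> exists s, x = wp s.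
Proof. by move=> [[s _ ->] _]; exists s. Qed.

Lemma min_coset_repE s : D (wp s) <-> min_rep A wp X J s.
Proof.
split=> [[[t tX st] smin]|[[t tX ts] sJ]].
  split=> [|b bJ]; first by exists t.
  apply: (ascent_nonneg H); apply: (smin (wp [:: b])); last 2 first.
  - exact/has_lengthE.
  - by rewrite -word_product_cat; apply/has_lengthE.
  by exists [:: b]; rewrite //= bJ.
split; first by exists t.
move=> u l l' [v vJ ->] /has_lengthE -> ; rewrite -word_product_cat => /has_lengthE ->.
exact: (len_min_coset H sJ vJ).
Qed.

Lemma left_weak_len x y : lw x y ->
  x = y \/ exists s t, [/\ x = wp s, y = wp t & (len s < len t)%N].
Proof.
elim=> {x y} [x y [j /left_weak_cover_word[s [-> -> len_js]]]|x|x y z _ + _].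
- by right; exists s, (j :: s); rewrite len_js.
- by left.
move=> [->//|[s [t [-> yE st]]]] [<-|[t' [u [yE' -> tu]]]]; right.
  by exists s, t.
exists s, u; split; [by []|by []|].
by have := len_eq (etrans (esym yE) yE'); lia.
Qed.

Lemma min_coset_rep_lower x y : lw x y -> D y -> D x.
Proof.
elim=> {x y} [x y [j /left_weak_cover_word[s [-> -> len_js]]]|//|x y z _ + _].
  by move=> /min_coset_repE /(min_rep_lower H len_js) /min_coset_repE.
by move=> xy yz /yz/xy.
Qed.

Lemma left_weak_first x y : lw x y ->
  x = y \/ exists j z, left_weak_cover j x z /\ lw z y.
Proof.
move=> xy; case: (clos_rt_rt1n _ _ _ _ xy) => {xy y} [|z y [j xz] zy]; first by left.
by right; exists j, z; split; last exact: clos_rt1n_rt.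
Qed.

Lemma left_weak_order : partial_order_on D lw.
Proof.
split=> [x _|x y _ _ xy yx|x y z _ _ _]; first exact: rt_refl; last exact: rt_trans.
case: (left_weak_len xy) => // [[s [t [xE yE st]]]].
case: (left_weak_len yx) => // [[t' [s' [yE' xE' ts]]]].
have := len_eq (etrans (esym xE) xE'); have := len_eq (etrans (esym yE) yE').
lia.
Qed.

(** [W^J] is closed downwards, so the first step of a chain from [x] to [y] stays inside it;
    conversely, a length difference of one leaves no room in between. *)
Lemma left_weak_coversE x y : D x -> D y ->
  covers_on D lw x y <-> exists j, left_weak_cover j x y.
Proof.
move=> Dx Dy; split=> [[_ _ xy nexy cov]|[j xy]].
  have [//|[j [z [xz zy]]]] := left_weak_first xy.
  have lxz : lw x z by apply: rt_step; exists j.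
  exists j; case: (cov z (min_coset_rep_lower zy Dy) lxz zy) => [zx|<- //].
  have [s [xE zE len_js]] := left_weak_cover_word xz.
  by have := len_eq (etrans (etrans (esym zE) zx) xE); lia.
have [s [xE yE len_js]] := left_weak_cover_word xy.
split=> //; first by apply: rt_step; exists j.
  by move=> exy; have := len_eq (etrans (etrans (esym xE) exy) yE); lia.
move=> z _ /left_weak_len[|[s1 [t1 [xE1 zE1 lt1]]]]; first by left.
move=> /left_weak_len[|[s2 [t2 [zE2 yE2 lt2]]]]; first by right.
have := len_eq (etrans (esym xE) xE1); have := len_eq (etrans (esym yE) yE2).
by have := len_eq (etrans (esym zE1) zE2); lia.
Qed.

Lemma simple_reflection_word_inj a b : wp [:: a] = wp [:: b] -> a = b.
Proof.
move=> /(weyl_root H)/(_ (e a)) /=; rewrite lattice_refl_self // lattice_refl_unit.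
move=> /rowP/(_ a); rewrite !mxE !eqxx /=; case: eqVneq => //= _; lia.
Qed.

Lemma cons_word_inj a b s : wp (a :: s) = wp (b :: s) -> a = b.
Proof.
move=> eqs; apply: simple_reflection_word_inj.
exact: (ev_cancelr H (s := [:: a]) (t := [:: b]) eqs).
Qed.

Lemma left_weak_cover_uniq j j' x y :
  left_weak_cover j x y -> left_weak_cover j' x y -> j = j'.
Proof.
move=> /left_weak_cover_word[s [xE yE _]] /left_weak_cover_word[t [xE' yE' _]].
apply: (@cons_word_inj _ _ s); rewrite -yE yE'.
by apply: (ev_catl H [:: j']); rewrite -xE.
Qed.

(* The label of a left weak cover [x < s_j x] is [j] with the coordinates of the
   coroot [x^-1 (alpha_j^vee)]. *)
Definition quotient_edge x y (l : 'I_n * 'rV[int]_n) :=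
  exists s, [/\ x = wp s, y = wp (l.1 :: s), len (l.1 :: s) = (len s).+1
    & l.2 = cact (rev s) (e l.1)].

Lemma quotient_edge_cover x y l : quotient_edge x y l -> left_weak_cover l.1 x y.
Proof. by move=> [s [-> -> len_s _]]; apply/left_weak_coverE. Qed.

Lemma cover_quotient_edge j x y : left_weak_cover j x y ->
  exists l, quotient_edge x y l.
Proof.
move=> /left_weak_cover_word[s [-> -> len_s]].
by exists (j, cact (rev s) (e j)), s.
Qed.

Lemma quotient_edge_uniq x y l l' :
  quotient_edge x y l -> quotient_edge x y l' -> l = l'.
Proof.
move=> ll ll'.
have := left_weak_cover_uniq (quotient_edge_cover ll) (quotient_edge_cover ll').
case: l l' ll ll' => [a r] [b r'] [s /= [xE _ _ ->]] [t /= [xE' _ _ ->]] ->.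
have st : wp s = wp t by rewrite -xE.
by rewrite (weyl_coroot H (ev_rev H st)).
Qed.

(** [commuting_square] makes opposite indices equal, and the commuting reflection [s_a] fixes
    [alpha_b^vee], so the coroots [z^-1 (alpha_b^vee)] and [x^-1 (alpha_b^vee)] agree. *)
Lemma quotient_square z x y m l1 l2 l3 l4 : x <> y ->
  quotient_edge z x l1 -> quotient_edge z y l2 ->
  quotient_edge x m l3 -> quotient_edge y m l4 ->
  l3 = l2 /\ A l1.1 l2.1 = 0.
Proof.
case: l1 l2 l3 l4 => [a r1] [b r2] [c r3] [d r4] /= nexy.
move=> [s /= [zE xE len_as _]] [s' /= [zE' yE len_bs' r2E]].
move=> [u /= [xE' mE len_cu r3E]] [v /= [yE' mE' len_dv _]].
have ss' : wp s = wp s' by rewrite -zE.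
have uE : wp u = wp (a :: s) by rewrite -xE.
have vE : wp v = wp (b :: s) by rewrite -yE' yE; apply: (ev_catl H [:: b]).
have neab : a != b.
  by apply/eqP => eab; apply: nexy; rewrite xE yE eab; apply: (ev_catl H [:: b]).
have cuE : wp (c :: u) = wp [:: c, a & s] by apply: (ev_catl H [:: c] uE).
have dvE : wp (d :: v) = wp [:: d, b & s] by apply: (ev_catl H [:: d] vE).
have neca : c != a.
  apply/eqP => eca; subst c.
  have := len_eq (ev_iil H a s); have := len_eq cuE; have := len_eq uE; lia.
have nedb : d != b.
  apply/eqP => edb; subst d.
  have := len_eq (ev_iil H b s); have := len_eq dvE; have := len_eq vE.
  have := len_eq (ev_catl H [:: b] ss'); have := len_eq ss'; rewrite /=; lia.
have eqw : wp [:: c; a] = wp [:: d; b].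
  by apply: (ev_cancelr H (u := s)); rewrite /= -cuE -dvE -mE.
have [cb _ ab0] := commuting_square H neab neca nedb eqw.
split=> //; congr (_, _) => //; rewrite r3E r2E (weyl_coroot H (ev_rev H uE)).
rewrite rev_cons -cats1 lattice_act_cat /= cb commuting_refl.
  by rewrite (weyl_coroot H (ev_rev H ss')).
by rewrite mxE; case: gcmA => _ _; apply.
Qed.

Hypothesis distr : is_distributive_lattice D lw.

Lemma quotient_up_commute (z : seq 'I_n) (a b : 'I_n) : a != b ->
  min_rep A wp X J (a :: z) -> min_rep A wp X J (b :: z) ->
  len (a :: z) = (len z).+1 -> len (b :: z) = (len z).+1 -> A a b = 0.
Proof.
case: distr => d [L [f iso]] neab min_a min_b len_a len_b.
have [Da Db] : D (wp (a :: z)) /\ D (wp (b :: z)) by split; apply/min_coset_repE.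
have Dz : D (wp z) by apply/min_coset_repE; apply: min_rep_lower len_a min_a.
have za : left_weak_cover a (wp z) (wp (a :: z)) by apply/left_weak_coverE.
have zb : left_weak_cover b (wp z) (wp (b :: z)) by apply/left_weak_coverE.
have neq : wp (a :: z) <> wp (b :: z).
  by move/cons_word_inj => eab; rewrite eab eqxx in neab.
have [||m [am bm]] := upper_square iso (z := wp z) _ _ neq.
- by apply/left_weak_coversE => //; exists a.
- by apply/left_weak_coversE => //; exists b.
have [_ Dm _ _ _] := am.
move: am bm => /(left_weak_coversE Da Dm)[c am] /(left_weak_coversE Db Dm)[k bm].
have [l3 e3] := cover_quotient_edge am; have [l4 e4] := cover_quotient_edge bm.
by have [] := @quotient_square (wp z) _ _ m (a, cact (rev z) (e a))
  (b, cact (rev z) (e b)) _ _ neq (ex_intro _ z (And4 erefl erefl len_a erefl))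
  (ex_intro _ z (And4 erefl erefl len_b erefl)) e3 e4.
Qed.

Lemma quotient_down_commute (y : seq 'I_n) (a b : 'I_n) : a != b ->
  min_rep A wp X J y ->
  len y = (len (a :: y)).+1 -> len y = (len (b :: y)).+1 -> A a b = 0.
Proof.
case: distr => d [L [f iso]] neab min_y len_a len_b.
have Dy : D (wp y) by apply/min_coset_repE.
have lower c : len y = (len (c :: y)).+1 ->
    left_weak_cover c (wp (c :: y)) (wp y) /\ D (wp (c :: y)).
  move=> len_c; have cov : left_weak_cover c (wp (c :: y)) (wp y).
    by apply/left_weak_coverE; rewrite (len_eq (ev_iil H c y)) (ev_iil H).
  split=> //; apply: min_coset_rep_lower Dy; apply: rt_step; by exists c.
have [ay Da] := lower a len_a; have [yb Db] := lower b len_b.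
have neq : wp (a :: y) <> wp (b :: y).
  by move/cons_word_inj => eab; rewrite eab eqxx in neab.
have [||z [za zb]] := lower_square iso (m := wp y) _ _ neq.
- by apply/left_weak_coversE => //; exists a.
- by apply/left_weak_coversE => //; exists b.
have [Dz _ _ _ _] := za.
move: za zb => /(left_weak_coversE Dz Da)[c za] /(left_weak_coversE Dz Db)[k zb].
have [l1 e1] := cover_quotient_edge za; have [l2 e2] := cover_quotient_edge zb.
have [l3 e3] := cover_quotient_edge ay; have [l4 e4] := cover_quotient_edge yb.
(* Only the upper labels are known; reading the square in both orientations identifies the lower
   ones with them. *)
have [l32 A12] := quotient_square neq e1 e2 e3 e4.
have [l41 _] := quotient_square (not_eq_sym neq) e2 e1 e4 e3.
have l3a : l3.1 = a.
  case: e3 => s [sE yE _ _]; apply: (@cons_word_inj _ _ s); rewrite -yE.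
  by have := ev_catl H [:: a] (esym sE); rewrite /= (ev_iil H) => ->.
have l4b : l4.1 = b.
  case: e4 => s [sE yE _ _]; apply: (@cons_word_inj _ _ s); rewrite -yE.
  by have := ev_catl H [:: b] (esym sE); rewrite /= (ev_iil H) => ->.
by case: gcmA => _ _; apply; rewrite -l3a -l4b l32 l41.
Qed.

Lemma positive_weight_nonneg (x : 'rV[int]_n) :
  positive_weight (root_of R x) <-> nonneg x.
Proof.
split=> [[c xE]|pos_x].
  have -> : x = \row_j (c j)%:Z.
    apply: (@root_of_inj _ _ _ R charF0); rewrite xE; apply: eq_bigr => j _.
    by rewrite mxE -pmulrn scaler_nat.
  by move=> j; rewrite mxE.
exists (fun j => absz (x 0 j)); apply: eq_bigr => j _.
by rewrite -scaler_nat pmulrn gez0_abs.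
Qed.

Lemma act_weight_word s i : act_weight (wp s) (alpha i) = root_of R (act s (e i)).
Proof.
apply/lfunP => z; rewrite root_of_act comp_lfunE root_of_unit.
by rewrite (word_product_inv R gcmA).
Qed.

Lemma coroot_word s i : wp s (alphav i) = coroot_of R (cact s (e i)).
Proof. by rewrite coroot_of_act coroot_of_unit. Qed.

Lemma reflection_word s i :
  (wp s \o simple_reflection R i \o (wp s)^-1)%VF = wp (s ++ i :: rev s).
Proof. by rewrite (word_product_inv R gcmA) word_product_cat /= comp_lfunA. Qed.

Lemma strong_edge_quotient (Lam : 'Hom(h, F^o)) x y m : D x -> D y ->
  strong_edge Lam x y m ->
  exists2 l, quotient_edge x y l & Lam (coroot_of R l.2) = m%:R :> F.
Proof.
move=> Dx Dy [_ [bv [_ [_ [u [i [[g0 _ ->] -> -> ->]]] + [yE len_xy] LamE]]]].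
rewrite act_weight_word => /positive_weight_nonneg pos_g0.
have [v xE] := min_coset_rep_word Dx; subst x.
move: LamE; rewrite coroot_word => LamE.
move: yE; rewrite reflection_word -word_product_cat => yE.
have len_y : len (v ++ g0 ++ i :: rev g0) = (len v).+1.
  by case: len_xy => l /has_lengthE ->; rewrite yE => /has_lengthE.
(* Right multiplication by the reflection in [g0 alpha_i] is left multiplication by the reflection
   in [g alpha_i], a root that is positive because the length grows. *)
pose g := v ++ g0.
have pos_g : nonneg (act g (e i)).
  case: (root_sign H g i) => //; rewrite lattice_act_cat.
  by move=> /(nonpos_reflection_len H pos_g0); rewrite len_y; lia.
have yE' : y = wp (g ++ i :: rev g ++ v).
  rewrite yE /g rev_cat -!catA.
  have := ev_revK H (v ++ g0 ++ i :: rev g0) v [::].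
  by rewrite !cats0 -!catA /= => <-.
have [a ga] : exists a, act g (e i) = e a.
  apply: (strong_cover_simple H quotient_up_commute quotient_down_commute (v := v)) => //.
  - exact/min_coset_repE.
  - by apply/min_coset_repE; move: Dy; rewrite yE'.
  by rewrite -len_y; apply: len_eq; rewrite -yE -yE'.
have yav : y = wp (a :: v).
  rewrite yE' -cat_cons catA.
  exact: (ev_catr H v (reflection_of_simple_root H ga)).
exists (a, cact (rev v) (e a)) => /=.
  exists v; split=> //=.
  by rewrite -len_y; apply: len_eq; rewrite -yav -yE.
(* Pulling [alpha_a^vee] back through [v] recovers the coroot whose pairing with [Lam] is the
   multiplicity. *)
rewrite -(coroot_of_simple_root H ga) lattice_act_cat lattice_actK //.
by move=> k; rewrite mxE.
Qed.

(** The reflection is that of [x^-1 alpha_j], positive because [s_j] lengthens [x]. Its coroot then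
    has nonnegative coordinates, which the absolute values leave unchanged. *)
Lemma quotient_edge_strong (Lam : 'Hom(h, F^o)) (c : 'I_n -> nat) x y l :
  (forall k, Lam (alphav k) = (c k)%:R :> F) -> quotient_edge x y l ->
  strong_edge Lam x y (\sum_k absz (l.2 0%R k) * c k)%N.
Proof.
case: l => j r LamE [s /= [-> -> len_s ->]].
have pos_j : nonneg (act (rev s) (e j)) by apply: (left_ascent_nonneg H); rewrite len_s.
exists (act_weight (wp (rev s)) (alpha j)), (wp (rev s) (alphav j)),
  (wp (rev s) \o simple_reflection R j \o (wp (rev s))^-1)%VF; split.
- exact: weyl_word.
- by exists (wp (rev s)), j; split=> //; apply: weyl_word.
- by rewrite act_weight_word; apply/positive_weight_nonneg.
- rewrite reflection_word -word_product_cat revK; split.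
    by rewrite (ev_Krev H [::] s (j :: s)).
  by exists (len s); apply/has_lengthE.
rewrite coroot_word linear_sum natr_sum; apply: eq_bigr => k _.
rewrite linearZ /= LamE natrM; congr (_ * _).
by rewrite pmulrn gez0_abs //; apply: (coroot_nonneg H).
Qed.

Hypothesis fin_X : finite_parabolic R X.

Lemma quotient_dll (lab : 'End(h) -> 'End(h) -> nat -> Prop)
    (value : 'I_n * 'rV[int]_n -> nat) :
  (forall x y l, D x -> D y -> quotient_edge x y l -> lab x y (value l)) ->
  (forall x y m, D x -> D y -> lab x y m -> exists l, quotient_edge x y l) ->
  (forall x y m m', D x -> D y -> lab x y m -> lab x y m' -> m = m') ->
  induced_graph_is_dll D lab.
Proof.
move=> edge_lab lab_edge lab_uniq; case: fin_X => ts tsP.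
have D1 : D (wp [::]).
  apply/min_coset_repE; split; first by exists [::].
  by move=> b _; apply: unit_row_nonneg.
have lab_cov x y m : D x -> D y -> lab x y m -> exists j, left_weak_cover j x y.
  move=> Dx Dy /(lab_edge _ _ _ Dx Dy) [l /quotient_edge_cover cov].
  by exists l.1.
apply: (squares_dll (le := lw) (edge := quotient_edge) (value := value)
  (ts := ts) D1) => //.
- by move=> x [xX _]; apply: tsP.
- exact: left_weak_order.
(* A chain of left weak covers ending in [W^J] lies wholly in [W^J], so it is a path of the induced
   graph. *)
- move=> x y Dx Dy; split; last first.
    apply: clos_refl_trans_sub => a b [Da Db [m /(lab_cov _ _ _ Da Db)]].
    exact: rt_step.
  move=> lxy; elim: (clos_rt_rt1n _ _ _ _ lxy) Dx Dy
    => {x y lxy} [z|x y z [j xy] yz IH] Dx Dz.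
    exact: rt_refl.
  have Dy : D y by apply: min_coset_rep_lower Dz; apply: clos_rt1n_rt.
  apply: rt_trans (IH Dy Dz); apply: rt_step; split=> //.
  by have [l /edge_lab labm] := cover_quotient_edge xy; exists (value l); apply: labm.
- move=> x y cov; have [Dx Dy _ _ _] := cov.
  by have /(left_weak_coversE Dx Dy)[j /cover_quotient_edge] := cov.
- by move=> z x y m l1 l2 l3 l4 nexy e1 e2 e3 e4; case: (quotient_square nexy e1 e2 e3 e4).
by move=> x y m Dx Dy labm; apply/left_weak_coversE => //; apply: lab_cov labm.
Qed.

End Quotient.

Theorem theorem7p1 (F : fieldType) (charF0 : [pchar F] =i pred0)
    (n : nat) (A : 'M[int]_n) (gcmA : generalized_cartan_matrix A)
    (R : realization F A) (g : kac_moody_algebra R)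
    (Lam : 'Hom(cartan R, F^o)) (Lam_dom : dominant_integral Lam)
    (K : cartan R) (k : 'I_n -> nat) (K_Zplus : Zplus g K k)
    (I' : {set 'I_n}) (fin_I' : finite_parabolic R I')
    (irr_I' : irreducible_nodes A I')
    (i : 'I_n) (i_in_I' : i \in I')
    (distr_WJ : is_distributive_lattice (min_coset_rep (R := R) I' (I' :\ i))
                  (left_weak_le (R := R))) :
  induced_graph_is_dll (min_coset_rep (R := R) I' (I' :\ i)) (strong_edge Lam) /\
  induced_graph_is_dll (min_coset_rep (R := R) I' (I' :\ i))
    (weak_edge (R := R) k).
Proof.
have [c cE] := fin_all_exists Lam_dom.
split.
  apply: (quotient_dll charF0 gcmA distr_WJ fin_I'
    (value := fun l => (\sum_k absz (l.2 0%R k) * c k)%N)).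
  - by move=> x y l Dx Dy; apply: quotient_edge_strong.
  - move=> x y m Dx Dy.
    by move=> /(strong_edge_quotient charF0 gcmA distr_WJ Dx Dy)[l exy _]; exists l.
  move=> x y m m' Dx Dy /(strong_edge_quotient charF0 gcmA distr_WJ Dx Dy)[l exy mE].
  move=> /(strong_edge_quotient charF0 gcmA distr_WJ Dx Dy)[l' exy' mE'].
  have ll' := quotient_edge_uniq charF0 gcmA exy exy'.
  (* Multiplicities are compared in [F], where characteristic zero separates them. *)
  have: (m%:Z)%:~R = (m'%:Z)%:~R :> F by rewrite -!pmulrn -mE ll' mE'.
  by move/(intr_inj_char0 charF0) => [].
apply: (quotient_dll charF0 gcmA distr_WJ fin_I' (value := fun l => k l.1)).
- move=> x y l Dx Dy exy; exists l.1 => //.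
  exact: quotient_edge_cover exy.
- by move=> x y m Dx Dy [j /cover_quotient_edge].
move=> x y m m' Dx Dy [j xy ->] [j' xy' ->].
by rewrite (left_weak_cover_uniq charF0 gcmA xy xy').
Qed.
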